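(* Let $\alpha,\beta,\gamma\in I(d)$ with $\alpha\le\beta\le\gamma$ and let $Y^\gamma_{\alpha,\beta}=X^\gamma_\alpha\cap\{p_\beta\ne0\}$, whose coordinate ring is $P/I$ with $I=(f_{\tau,\beta}:\tau\in I(d),\ \alpha\not\le\tau\text{ or }\tau\not\le\gamma)$. Then the (images of the) standard monomials on $Y^\gamma_{\alpha,\beta}$ form a $k$-basis of $k[Y^\gamma_{\alpha,\beta}]=P/I$.
   Context: Setup. $k$ is an algebraically closed field of characteristic $\neq2$, $d\ge1$, $V=k^{2d}$ with basis $e_1,\dots,e_{2d}$ and symmetric form $\langle e_i,e_j\rangle=1$ if $j=2d+1-i$, $0$ otherwise; $m^*=2d+1-m$. $I(d)$ is the set of $d$-subsets of $\{1,\dots,2d\}$ containing exactly one of $m,m^*$ for each $m$ and having an even number of elements $>d$; $v\le w$ iff $v_i\le w_i$ for the sorted entries. The orthogonal Grassmannian $OG$ is the $SO(V)$-orbit of $\langle e_1,\dots,e_d\rangle$ among maximal isotropic subspaces, Plücker-embedded with coordinates $p_\theta$. With $B$, $B^-$ the upper, lower triangular elements of $SO(V)$, $e_\theta=\langle e_i:i\in\theta\rangle$, $X^\gamma=\overline{Be_\gamma}$, $X_\alpha=\overline{B^-e_\alpha}$, and $X_\alpha^\gamma=X_\alpha\cap X^\gamma$ (reduced). Coordinates: $\mathfrak R(\beta)=\{(r,c):r\notin\beta,c\in\beta,r<c^*\}$, $P=k[X_{(r,c)}:(r,c)\in\mathfrak R(\beta)]$; the patch $OG\cap\{p_\beta\neq0\}$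 is the affine space with coordinate ring $P$, a point corresponding to the column span of the matrix $M$ (rows $1..2d$, columns $\beta$) with $M_{r,c}=\delta_{rc}$ for $r\in\beta$ and, for $r\notin\beta$, $M_{r,c}=X_{(r,c)}$ if $r<c^*$, $0$ if $r=c^*$, $-X_{(c^*,r^* )}$ if $r>c^*$. For $\theta\in I(d)$ with $\theta\setminus\beta=\{r_1<\dots<r_{2s}\}$, $f_{\theta,\beta}$ is the Pfaffian of the skew-symmetric $2s\times2s$ matrix $N$ with $N_{ij}=X_{(r_i,r_j^* )}$ for $i<j$ ($f_{\beta,\beta}=1$); the $\beta$-degree of $\theta$ is $s$. Standard monomials. A product $f_{\theta_1,\beta}\cdots f_{\theta_r,\beta}$ with $\theta_i\in I(d)$ is a standard monomial if $\theta_1\le\dots\le\theta_r$ and for each $i$ either $\theta_i<\beta$ or $\theta_i>\beta$ (strictly); it is standard on $Y^\gamma_{\alpha,\beta}$ if moreover $\alpha\le\theta_1$ and $\theta_r\le\gamma$. Its degree is the sum of the $\beta$-degrees of the $\theta_i$. *)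

(* Defs.v *)
From HB Require Import structures.
From mathcomp Require Import all_boot all_order all_algebra.
Set Implicit Arguments. Unset Strict Implicit. Unset Printing Implicit Defensive.
Import GRing.Theory.
Local Open Scope ring_scope.

Fixpoint mpoly (k : comNzRingType) (n : nat) : comNzRingType :=
  match n with 0 => k | n'.+1 => GRing.ComNzRing.clone _ {poly mpoly k n'} end.

Fixpoint mconst (k : comNzRingType) n : k -> mpoly k n :=
  match n with 0 => id | n'.+1 => fun c => (@mconst k n' c)%:P end.

Fixpoint mvar (k : comNzRingType) n (i : nat) : mpoly k n :=
  match n with 0 => 0 | n'.+1 => if i == n' then 'X else (@mvar k n' i)%:P end.

Definition MPoly (k : comNzRingType) (V : finType) : comNzRingType := mpoly k #|V|.
Definition MVar (k : comNzRingType) (V : finType) (v : V) : MPoly k V :=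
  @mvar k #|V| (enum_rank v).
Definition MConst (k : comNzRingType) (V : finType) (c : k) : MPoly k V :=
  @mconst k #|V| c.

(* For a skew-symmetric matrix whose entries above the diagonal are a x y
   (x before y in the list l), Pf = sum_{j} (-1)^j a l_1 l_j Pf(minor). *)
Fixpoint pf_rec (R : comNzRingType) (T : Type) (a : T -> T -> R)
    (fuel : nat) (l : seq T) : R :=
  match fuel, l with
  | 0, _ => 1
  | _, [::] => 1
  | fuel'.+1, x :: l' =>
      \sum_(p < size l') (-1) ^+ p * a x (nth x l' p)
                         * @pf_rec R T a fuel' (take p l' ++ drop p.+1 l')
  end.
Definition pfaff (R : comNzRingType) (T : Type) (a : T -> T -> R) (l : seq T) : R :=
  pf_rec a (size l) l.

(* index m (1-based) is represented by m-1 : 'I_(d.*2);  m* = 2d+1-m  becomes rev_ord *)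
Definition idx (d : nat) := 'I_(d.*2).
Definition star (d : nat) (m : idx d) : idx d := rev_ord m.

Definition inI (d : nat) (th : {set idx d}) : bool :=
  [&& #|th| == d,
      [forall m : idx d, (m \in th) != (star m \in th)] &
      ~~ odd #|[set m in th | (d <= val m)%N]| ].

Definition sorted_entries (d : nat) (th : {set idx d}) : seq nat :=
  sort leq (map val (enum th)).

Definition leI (d : nat) (v w : {set idx d}) : bool :=
  all2 leq (sorted_entries v) (sorted_entries w).
Definition ltI (d : nat) (v w : {set idx d}) : bool := leI v w && (v != w).

(* ---------- The coordinate ring P of the patch {p_beta <> 0} ---------- *)
Definition Rset (d : nat) (be : {set idx d}) : {set idx d * idx d} :=
  [set rc | [&& rc.1 \notin be, rc.2 \in be & (val rc.1 < val (star rc.2))%N]].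

Definition Rvar (d : nat) (be : {set idx d}) : finType :=
  {rc : idx d * idx d | rc \in Rset be}.

Definition Pring (k : comNzRingType) (d : nat) (be : {set idx d}) : comNzRingType :=
  MPoly k (Rvar be).

(* X_(r,c); only ever used for (r,c) \in R(beta) (default 0 otherwise) *)
Definition Xv (k : comNzRingType) (d : nat) (be : {set idx d}) (rc : idx d * idx d)
  : Pring k be :=
  match insub rc : option (Rvar be) with Some v => @MVar k _ v | None => 0 end.

Definition fpl (k : comNzRingType) (d : nat) (th be : {set idx d}) : Pring k be :=
  pfaff (fun r r' : idx d => Xv k be (r, star r'))
        (sort (fun x y : idx d => (val x <= val y)%N) (enum (th :\: be))).

Definition std_mono (k : comNzRingType) (d : nat) (be : {set idx d})
  (ths : seq {set idx d}) : Pring k be :=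
  \prod_(th <- ths) fpl k th be.

Definition is_std_on (d : nat) (al be ga : {set idx d}) (ths : seq {set idx d}) : bool :=
  [&& all (@inI d) ths,
      sorted (@leI d) ths,
      all (fun th => ltI th be || ltI be th) ths,
      (if ths is th1 :: _ then leI al th1 else true) &
      leI (last ga ths) ga ].

Definition bad (d : nat) (al ga : {set idx d}) (ta : {set idx d}) : bool :=
  inI ta && (~~ leI al ta || ~~ leI ta ga).

Definition inIdeal (k : comNzRingType) (d : nat) (al be ga : {set idx d})
  (h : Pring k be) : Prop :=
  exists g : {set idx d} -> Pring k be,
    h = \sum_(ta : {set idx d} | bad al ga ta) g ta * fpl k ta be.

Definition lincomb (k : comNzRingType) (d : nat) (be : {set idx d})
  (cs : seq (k * seq {set idx d})) : Pring k be :=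
  \sum_(cm <- cs) MConst (Rvar be) cm.1 * std_mono k be cm.2.

(* Main.v *)
Require Import Defs.
From HB Require Import structures.
From mathcomp Require Import all_boot all_order all_algebra.
From mathcomp Require Import zify ring.
Set Implicit Arguments. Unset Strict Implicit. Unset Printing Implicit Defensive.
Import GRing.Theory.
Local Open Scope ring_scope.

(** A theta in I(d) is encoded by the even set S of those m with m* in theta, and the
    Bruhat order becomes domination of the lattice paths m |-> #{s in S, s < m}.  The
    Pfaffians f_theta, indexed by S, form a pure spinor: they satisfy the Wick (Cartan)
    quadrics, and conversely a pure spinor whose coordinate at beta is 1 is given by
    Pfaffians of its coordinates at distance two from beta.

    Independence: acting on the vector e_alpha by factors 1 + X^w e, one simple root
    operator e for each cell between the paths alpha and gamma, gives a pure spinor over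
    k[X] whose coordinates vanish outside [alpha, gamma] and whose degrees are sums of
    cell weights.  Specializing there kills I, and sends distinct chains to polynomials
    of distinct degrees.

    Spanning: in degree two a discrete Fourier transform diagonalizes the Wick quadrics
    and bounds the span of the products f_theta f_tau of given torus weight by
    binomial(2r-1, r), which by the reflection principle is also the number of
    comparable pairs; these are independent, hence they span.  Comparing degrees makes
    this a terminating rewriting of products into chains.  Multiplying first by enough
    factors f_beta = 1 forces beta into the chains, so that all their members are
    comparable to beta.  A standard monomial which is not standard on Y has a factor
    that generates I. *)

(** * Wick relations *)

Definition xorset (T : finType) (A B : {set T}) : {set T} :=
  [set x | (x \in A) (+) (x \in B)].
Notation "A :+: B" := (xorset A B) (at level 50, left associativity).

Section XorSet.
Variable T : finType.
Implicit Types A B C : {set T}.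

Lemma in_xorset x A B : (x \in A :+: B) = (x \in A) (+) (x \in B).
Proof. by rewrite inE. Qed.
Lemma xorsetC : commutative (@xorset T).
Proof. by move=> A B; apply/setP=> x; rewrite !inE addbC. Qed.
Lemma xorsetA : associative (@xorset T).
Proof. by move=> A B C; apply/setP=> x; rewrite !inE addbA. Qed.
Lemma xorset0 : right_id set0 (@xorset T).
Proof. by move=> A; apply/setP=> x; rewrite !inE addbF. Qed.
Lemma xor0set : left_id set0 (@xorset T).
Proof. by move=> A; rewrite xorsetC xorset0. Qed.
Lemma xorsetv A : A :+: A = set0.
Proof. by apply/setP=> x; rewrite !inE addbb. Qed.
Lemma xorsetK B : involutive (fun A => A :+: B).
Proof. by move=> A; rewrite -xorsetA xorsetv xorset0. Qed.
Lemma xorsetKl B : involutive (xorset B).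
Proof. by move=> A; rewrite xorsetA xorsetv xor0set. Qed.
Lemma xorsetAC A B C : A :+: B :+: C = A :+: C :+: B.
Proof. by rewrite -!xorsetA (xorsetC B). Qed.
Lemma xorsetACA A B C D : (A :+: B) :+: (C :+: D) = (A :+: C) :+: (B :+: D).
Proof. by rewrite -!xorsetA (xorsetA B) (xorsetC B C) -xorsetA. Qed.

Lemma eq_odd_card A B : A =i B -> odd #|A| = odd #|B|.
Proof. by move=> /setP->. Qed.

Lemma odd_card_xor A B : odd #|A :+: B| = odd #|A| (+) odd #|B|.
Proof.
have -> : A :+: B = (A :\: B) :|: (B :\: A).
  by apply/setP=> x; rewrite !inE; do 2 case: (_ \in _).
rewrite cardsU (_ : _ :&: _ = set0) ?cards0 ?subn0.
  rewrite oddD -(cardsID B A) -(cardsID A B) !oddD (setIC B A).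
  by do 3 case: (odd _).
by apply/setP=> x; rewrite !inE; do 2 case: (_ \in _).
Qed.

Lemma odd_card_xor1 A x : odd #|A :+: [set x]| = ~~ odd #|A|.
Proof. by rewrite odd_card_xor cards1 addbT. Qed.

Lemma odd_card_sep1 (P : pred T) x : odd #|[set y in [set x] | P y]| = P x.
Proof.
case Px: (P x).
  have -> : [set y in [set x] | P y] = [set x]; last by rewrite cards1.
  by apply/setP=> y; rewrite !inE andb_idr // => /eqP->.
have -> : [set y in [set x] | P y] = set0; last by rewrite cards0.
by apply/setP=> y; rewrite !inE; apply/negP=> /andP[/eqP->]; rewrite Px.
Qed.

End XorSet.

(** * Invariance of the Cartan quadrics under the spin group *)

Section Wick.
Variables (d : nat) (rho : 'I_d -> nat).
Hypothesis rho_inj : injective rho.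
Implicit Types (S B U : {set 'I_d}) (i j l : 'I_d).

Definition before U i := #|[set j in U | (rho j < rho i)%N]|.
Definition between i j U := [set l in U | (rho i < rho l < rho j)%N || (rho j < rho l < rho i)%N].

(* The Cartan quadrics of the spin representation: the coefficient at (B, B') of
   sum_i (a_i (x) a_i^* + a_i^* (x) a_i) (psi (x) psi), up to a global sign. *)
Definition wick (R : comNzRingType) (psi : {set 'I_d} -> R) B B' : R :=
  \sum_(i in B :+: B') (-1) ^+ before (B :+: B') i
     * psi (B :+: [set i]) * psi (B' :+: [set i]).
Definition pure (R : comNzRingType) (psi : {set 'I_d} -> R) := forall B B', wick psi B B' = 0.

Definition pairset i j : {set 'I_d} := [set i] :+: [set j].

(* 1 + x e, with e one of the products of a creation or annihilation operator at
   each of the sites i and j; a and b are the occupancies of its output. *)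
Definition pairop (R : comNzRingType) i j (a b : bool) (x : R) (psi : {set 'I_d} -> R) S : R :=
  psi S + (if ((i \in S) == a) && ((j \in S) == b)
           then x * (-1) ^+ #|between i j S| * psi (S :+: pairset i j) else 0).

Lemma pairset_sym i j : pairset i j = pairset j i.
Proof. by rewrite /pairset xorsetC. Qed.

Lemma odd_before_xor U V i : odd (before (U :+: V) i) = odd (before U i) (+) odd (before V i).
Proof.
rewrite /before -odd_card_xor; apply: eq_odd_card => x.
by rewrite !inE; case: (_ < _)%N; rewrite ?andbT ?andbF.
Qed.

Lemma odd_before1 i l : odd (before [set i] l) = (rho i < rho l)%N.
Proof. by rewrite /before odd_card_sep1. Qed.

Lemma odd_between_xor i j U V :
  odd #|between i j (U :+: V)| = odd #|between i j U| (+) odd #|between i j V|.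
Proof.
rewrite /between -odd_card_xor; apply: eq_odd_card => x.
by rewrite !inE; case: (_ || _); rewrite ?andbT ?andbF.
Qed.

Lemma odd_between1 i j l : odd #|between i j [set l]|
  = (rho i < rho l < rho j)%N || (rho j < rho l < rho i)%N.
Proof. by rewrite /between odd_card_sep1. Qed.

Lemma odd_before_between i j U : (rho i < rho j)%N ->
  odd (before U j) = odd (before U i) (+) (i \in U) (+) odd #|between i j U|.
Proof.
move=> ij; have -> : (i \in U) = odd #|[set x in U | x == i]|.
  have -> : [set x in U | x == i] = [set x in [set i] | x \in U].
    by apply/setP=> x; rewrite !inE andbC.
  by rewrite odd_card_sep1.
rewrite /before /between -!odd_card_xor; apply: eq_odd_card => x.
rewrite !inE; case: (x \in U) => //=.
have -> : (x == i) = (rho x == rho i) by rewrite inj_eq.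
by case: (ltngtP (rho x) (rho i)) => h1; case: (ltngtP (rho x) (rho j)) => h2 //=; lia.
Qed.

Lemma between_sym i j U : between i j U = between j i U.
Proof. by apply/setP=> x; rewrite !inE orbC. Qed.

Lemma pairop_sym (R : comNzRingType) i j a b x (psi : {set 'I_d} -> R) S :
  pairop i j a b x psi S = pairop j i b a x psi S.
Proof. by rewrite /pairop pairset_sym between_sym andbC. Qed.

Section Invariance.
Variables (R : comNzRingType) (i j : 'I_d) (a b : bool) (x : R) (psi : {set 'I_d} -> R).
Hypothesis ij : (rho i < rho j)%N.

Let E := pairset i j.
Let coef S : R :=
  if ((i \in S) == a) && ((j \in S) == b) then (-1) ^+ odd #|between i j S| else 0.
Let op := pairop i j a b x psi.

Let opE S : op S = psi S + x * coef S * psi (S :+: E).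
Proof.
by rewrite /op /pairop /coef; case: ifP; rewrite ?mulr0 ?mul0r // signr_odd.
Qed.

Let sgn U l : R := if l \in U then (-1) ^+ odd (before U l) else 0.

Let wickE (f : {set 'I_d} -> R) B B' : wick f B B' =
  \sum_l sgn (B :+: B') l * f (B :+: [set l]) * f (B' :+: [set l]).
Proof.
rewrite /wick big_mkcond; apply: eq_bigr => l _.
by rewrite /sgn; case: ifP; rewrite ?mul0r // signr_odd.
Qed.

Let xorEi B : B :+: [set i] :+: E = B :+: [set j].
Proof. by rewrite /E /pairset -xorsetA xorsetKl. Qed.
Let xorEj B : B :+: [set j] :+: E = B :+: [set i].
Proof. by rewrite /E pairset_sym /pairset -xorsetA xorsetKl. Qed.

Let ijN : (j == i) = false.
Proof. by apply/eqP=> e; move: ij; rewrite e ltnn. Qed.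
Let ijN' : (i == j) = false. Proof. by rewrite eq_sym. Qed.

(** The operator e comes from the spin Lie algebra, and the Cartan form commutes with its diagonal
    action. So 1 + x e, acting on both tensor factors, only replaces the quadric at (B, B') by a
    combination of quadrics. *)
Lemma wick_pairop B B' : wick op B B' =
  wick psi B B' + x * (coef B * wick psi (B :+: E) B'
                           + coef B' * wick psi B (B' :+: E))
  + x ^+ 2 * (coef B * coef B' * wick psi (B :+: E) (B' :+: E)).
Proof.
rewrite !wickE.
have -> : B :+: E :+: (B' :+: E) = B :+: B' by rewrite xorsetACA xorsetv xorset0.
have -> : B :+: (B' :+: E) = B :+: B' :+: E by rewrite xorsetA.
have -> : B :+: E :+: B' = B :+: B' :+: E by rewrite xorsetAC.
set U := B :+: B'.
apply/eqP; rewrite -subr_eq0; apply/eqP.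
rewrite !mulrDr !mulr_sumr -!big_split /= -sumrB.
rewrite (bigD1 i) // (bigD1 j) /=; last by rewrite ijN.
rewrite big1 ?addr0; last first.
  move=> l /andP[li lj]; rewrite !opE.
  have sE B1 : B1 :+: E :+: [set l] = B1 :+: [set l] :+: E by rewrite xorsetAC.
  rewrite !sE.
  (* Away from i and j the summands match one by one. The sign [c] enters through [coef] on one side
     and through [sgn (U :+: E)] on the other; in the quadratic term it occurs squared. *)
  set c := (-1) ^+ odd #|between i j [set l]| : R.
  have cE B1 : coef (B1 :+: [set l]) = coef B1 * c.
    rewrite /coef !inE (eq_sym i l) (eq_sym j l) (negPf li) (negPf lj) !addbF.
    by case: ifP => _; rewrite ?mul0r // odd_between_xor signr_addb.
  have sgE : sgn (U :+: E) l = sgn U l * c.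
    rewrite /sgn !inE (negPf li) (negPf lj) !addbF.
    case: ifP => _; rewrite ?mul0r // odd_before_xor signr_addb; congr (_ * _).
    rewrite /c odd_before_xor !odd_before1 odd_between1; congr ((-1) ^+ nat_of_bool _).
    have ni : rho i != rho l by rewrite (inj_eq rho_inj) eq_sym.
    have nj : rho j != rho l by rewrite (inj_eq rho_inj) eq_sym.
    by move: ni nj; do 2 case: ltngtP => ?; rewrite //=; lia.
  have cc : c * c = 1 by rewrite /c -signr_addb addbb.
  rewrite !cE sgE; ring: cc.
rewrite !opE !xorEi !xorEj.
have sEi B1 : B1 :+: E :+: [set i] = B1 :+: [set j] by rewrite xorsetAC xorEi.
have sEj B1 : B1 :+: E :+: [set j] = B1 :+: [set i] by rewrite xorsetAC xorEj.
rewrite !sEi !sEj.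
have bU : odd #|between i j U| = odd #|between i j B| (+) odd #|between i j B'|.
  by rewrite odd_between_xor.
have bEi : odd #|between i j [set i]| = false by rewrite odd_between1 !ltnn andbF.
have bEj : odd #|between i j [set j]| = false by rewrite odd_between1 !ltnn andbF.
have pE : odd (before U j) = odd (before U i) (+) (i \in U) (+)
   (odd #|between i j B| (+) odd #|between i j B'|).
  by rewrite (odd_before_between _ ij) bU.
have bE l : odd (before E l) = (rho i < rho l)%N (+) (rho j < rho l)%N.
  by rewrite /E /pairset odd_before_xor !odd_before1.
have si : odd (before (U :+: E) i) = odd (before U i).
  by rewrite odd_before_xor bE ltnn (ltnNge (rho j)) (ltnW ij) /= addbF.
have sj : odd (before (U :+: E) j) = ~~ odd (before U j).
  by rewrite odd_before_xor bE ltnn ij /= addbT.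
rewrite /sgn si sj pE /coef !odd_between_xor bEi bEj /U /E /pairset !inE !eqxx ijN ijN' /=.
(* The summands at i and j cancel only jointly. They depend on the occupancies of the two sites, on
   a and b, and on three parities, which leaves finitely many polynomial identities in four values
   of [psi]. *)
move: (i \in B) (j \in B) (i \in B') (j \in B') => u v u' v'.
move: (odd (before _ i)) (odd #|between i j B|) (odd #|between i j B'|) => p q q'.
move: (psi _) (psi _) (psi _) (psi _) => p1 p2 p3 p4.
case: u; case: v; case: u'; case: v'; case: a; case: b => /=;
 rewrite ?mul0r ?mulr0 ?add0r ?addr0 ?subrr //;
 case: p; case: q; case: q' => /=; rewrite ?expr0 ?expr1; ring.
Qed.

End Invariance.

Lemma pure_pairop (R : comNzRingType) i j a b (x : R) psi :
  i != j -> pure psi -> pure (pairop i j a b x psi).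
Proof.
move=> ij psiP B B'; have := ij; rewrite -(inj_eq rho_inj) neq_ltn => /orP[h|h].
  by rewrite (wick_pairop a b x psi h) !psiP !(mulr0, addr0).
rewrite -[RHS](_ : wick (pairop j i b a x psi) B B' = 0).
  by apply: eq_bigr => l _; rewrite !(pairop_sym i j).
by rewrite (wick_pairop b a x psi h) !psiP !(mulr0, addr0).
Qed.

End Wick.

(** * Pure spinors as vectors of Pfaffians *)

Section WickPfaffian.
Variables (d : nat) (rho : 'I_d -> nat).
Hypothesis rho_inj : injective rho.
Variable R : comNzRingType.
Implicit Types (S B U be : {set 'I_d}) (i j : 'I_d) (psi : {set 'I_d} -> R) (l : seq 'I_d).

Let rho_lt := relpre rho ltn.
Let rho_lt_trans : transitive rho_lt. Proof. by move=> x y z; apply: ltn_trans. Qed.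
Let rho_lt_irr : irreflexive rho_lt. Proof. by move=> x; apply: ltnn. Qed.

Lemma eq_pure psi psi' : psi =1 psi' -> pure rho psi -> pure rho psi'.
Proof.
by move=> e h B B'; rewrite -(h B B'); apply: eq_bigr => i _; rewrite !e.
Qed.

Lemma pure_scale psi c : pure rho psi -> pure rho (fun S => c * psi S).
Proof.
move=> h B B'; rewrite -[RHS](mulr0 (c ^+ 2)) -(h B B') mulr_sumr.
by apply: eq_bigr => i _; ring.
Qed.

(** A nonzero summand would force B = B', and then the sum is empty. *)
Lemma pure_vacuum be (c : R) : pure rho (fun S => if S == be then c else 0).
Proof.
move=> B B'; apply: big1 => i; case: eqP => [e|_]; last by rewrite mulr0 mul0r.
case: eqP => [e'|_]; last by rewrite mulr0.
have -> : B = B'; first by rewrite -(xorsetK [set i] B) e -e' xorsetK.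
by rewrite xorsetv inE.
Qed.

Lemma before_sorted l x0 p : sorted rho_lt l -> (p < size l)%N ->
  before rho [set i in l] (nth x0 l p) = p.
Proof.
move=> sl pl; set y := nth x0 l p.
have ul : uniq l := sorted_uniq rho_lt_trans rho_lt_irr sl.
have -> : before rho [set i in l] y = count (fun i => rho i < rho y)%N l.
  rewrite /before -size_filter -(card_uniqP (filter_uniq _ ul)).
  by apply: eq_card => i; rewrite !inE mem_filter andbC.
rewrite {}/y {ul}; elim: l p sl pl => [|z l IH] [|p] //= pl.
  move=> _; rewrite ltnn add0n; apply/eqP; rewrite -leqn0 leqNgt -has_count.
  apply/hasPn=> w wl; rewrite -leqNgt ltnW //.
  by have /allP/(_ _ wl) := order_path_min rho_lt_trans pl.
rewrite ltnS => pl2; rewrite IH ?(path_sorted pl) //.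
by have /allP/(_ _ (mem_nth x0 pl2)) := order_path_min rho_lt_trans pl; rewrite /rho_lt /= => ->.
Qed.

(** The Wick quadric at [be :+: [set x]] and [be :+: [set i in l]] is the expansion of the Pfaffian
    along its first row x: the summand at x is the coordinate sought, and the one at the p-th entry
    of l has sign $(-1)^{p+1}$. *)
Lemma pure_pf_rec psi be (a : 'I_d -> 'I_d -> R) fuel l :
  pure rho psi -> psi be = 1 ->
  (forall i j, (rho i < rho j)%N -> a i j = psi (be :+: pairset i j)) ->
  sorted rho_lt l -> ~~ odd (size l) -> (size l <= fuel)%N ->
  pf_rec a fuel l = psi (be :+: [set i in l]).
Proof.
move=> psiP be1 aE; have nilE : psi (be :+: [set i in [::]]) = 1.
  by rewrite (_ : [set i in [::]] = set0) ?xorset0 //; apply/setP=> x; rewrite !inE.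
elim: fuel l => [|fuel IH] [|x l] //= sl ol; rewrite ltnS => szl.
have sl' : sorted rho_lt (x :: l) := sl.
have ul : uniq (x :: l) := sorted_uniq rho_lt_trans rho_lt_irr sl'.
have /andP[xl ul'] := ul.
have lE : [set i in x :: l] = [set x] :+: [set i in l].
  apply/setP=> i; rewrite !inE; case: eqP => //= ->.
  by rewrite (negPf xl).
pose B := be :+: [set x]; pose B' := be :+: [set i in l].
have := psiP B B'; rewrite /wick.
have -> : B :+: B' = [set i in x :: l].
  by rewrite /B /B' xorsetACA xorsetv xor0set lE.
rewrite (eq_bigl (fun i => i \in x :: l)) => [|i]; last by rewrite inE.
rewrite -big_uniq // big_cons.
have -> : before rho [set i in x :: l] x = 0%N by apply: (@before_sorted _ x 0 sl').
rewrite /B xorsetK be1 expr0 !mul1r /B' -xorsetA (xorsetC _ [set x]) -lE => /eqP.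
rewrite addr_eq0 => /eqP ->; rewrite (big_nth x) big_mkord -sumrN.
apply: eq_bigr => -[p pl] _ /=.
have -> := @before_sorted (x :: l) x p.+1 sl' pl.
rewrite exprS; set y := nth x l p.
have xy : rho_lt x y.
  by have /allP/(_ _ (mem_nth x pl)) := order_path_min rho_lt_trans sl.
have lcat : l = take p l ++ y :: drop p.+1 l by rewrite -drop_nth // cat_take_drop.
have rest : subseq (take p l ++ drop p.+1 l) l.
  by rewrite {3}lcat cat_subseq // subseq_cons.
rewrite IH; last 1 first.
- rewrite (leq_trans _ szl) //; exact: size_subseq rest.
- rewrite -xorsetA -/(pairset x y) -aE //.
  have -> : [set i in l] = [set i in take p l ++ drop p.+1 l] :+: [set y].
    have : uniq (take p l ++ y :: drop p.+1 l) by rewrite -lcat.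
    rewrite cat_uniq cons_uniq => /and3P[_ /norP[yt _] /andP[yd _]].
    have memE i : (i \in l) = (i \in take p l ++ y :: drop p.+1 l) by rewrite -lcat.
    apply/setP=> i; rewrite !inE memE !mem_cat inE.
    by case: eqP => [->|_] /=; rewrite ?addbF // (negPf yt) (negPf yd).
  by rewrite xorsetA xorsetK; ring.
- exact: (subseq_sorted rho_lt_trans rest (path_sorted sl)).
have : size l = (size (take p l ++ drop p.+1 l)).+1.
  by rewrite -{1}(cat_take_drop p l) (drop_nth x pl) !size_cat /= addnS.
by move: ol => /= ol e; move: ol; rewrite negbK e.
Qed.

(** Starting from the vacuum at [be], one operator per pair of sites installs the corresponding
    entry of Y. *)
Lemma exists_pure_generic be (Y : 'I_d -> 'I_d -> R) :
  exists psi, [/\ pure rho psi, psi be = 1,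
    forall S, odd #|S :+: be| -> psi S = 0 &
    forall i j, (rho i < rho j)%N -> psi (be :+: pairset i j) = Y i j].
Proof.
pose ps := [seq ij <- enum (('I_d * 'I_d)%type : finType) | (rho ij.1 < rho ij.2)%N].
suff [psi [h1 h2 h3 h4]] : exists psi, [/\ pure rho psi, psi be = 1,
    forall S, odd #|S :+: be| -> psi S = 0 &
    forall i j, (rho i < rho j)%N ->
      psi (be :+: pairset i j) = if (i, j) \in ps then Y i j else 0].
  exists psi; split=> // i j ij; rewrite h4 // mem_filter mem_enum ij //.
have : uniq ps by rewrite filter_uniq // enum_uniq.
have : all (fun ij => (rho ij.1 < rho ij.2)%N) ps.
  by apply/allP=> ij; rewrite mem_filter => /andP[].
elim: ps => [|[i j] ps IH] /=.
  move=> _ _; exists (fun S => if S == be then 1 else 0); split=> //.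
  - exact: pure_vacuum.
  - by rewrite eqxx.
  - by move=> S; case: eqP => // ->; rewrite xorsetv cards0.
  - move=> i j ij; case: eqP => // e.
    have : i \in (set0 : {set 'I_d}).
      rewrite -(xorsetv be) -{2}e xorsetA xorsetv xor0set !inE eqxx.
      by case: eqP => // ij'; rewrite ij' ltnn in ij.
    by rewrite inE.
move=> /andP[ij aps] /andP[ijps ups].
have ijN : (i == j) = false by apply/eqP=> e; rewrite e ltnn in ij.
have jiN : (j == i) = false by rewrite eq_sym.
have [psi [h1 h2 h3 h4]] := IH aps ups.
(* [c] cancels the sign that [pairop] produces at this coordinate. The occupancies chosen below make
   the operator act only on outputs that differ from [be] at both i and j, so it leaves every other
   coordinate at distance two alone. *)
pose c : R := (-1) ^+ #|between rho i j (be :+: pairset i j)|.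
have cc : c * c = 1 by rewrite /c -expr2 sqrr_sign.
exists (pairop rho i j (i \notin be) (j \notin be) (Y i j * c) psi); split.
- by apply: pure_pairop => //; rewrite ijN.
- by rewrite /pairop h2; case: (i \in be); rewrite addr0.
- move=> S oS; rewrite /pairop h3 // add0r h3 ?mulr0 ?if_same //.
  by rewrite xorsetAC odd_card_xor oS /pairset odd_card_xor !cards1.
move=> k l kl; rewrite /pairop in_cons h4 // xpair_eqE.
have [/andP[/eqP-> /eqP->]|kl'] := boolP ((k == i) && (l == j)).
  rewrite (negPf ijps) !inE !eqxx ijN jiN addbT addbF /= !addbT !eqxx /= add0r.
  by rewrite -/c xorsetK h2 mulr1 -mulrA cc mulr1.
rewrite [X in _ + X](_ : _ = 0) ?addr0 //.
case: ifP => // /andP[]; rewrite !inE.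
have kl'' : (k == l) = false by apply/eqP=> e; rewrite e ltnn in kl.
move=> e1 e2.
have {}e1 : (i == k) || (i == l) by move: e1; case: (i == k); case: (i == l); case: (i \in be).
have {}e2 : (j == k) || (j == l) by move: e2; case: (j == k); case: (j == l); case: (j \in be).
move: kl'; case/orP: e1 => /eqP e1; case/orP: e2 => /eqP e2; subst.
- by rewrite eqxx in ijN.
- by rewrite !eqxx.
- by move: ij kl; lia.
- by rewrite eqxx in ijN.
Qed.

End WickPfaffian.

(** * Lattice paths and spinors with prescribed degrees *)

Section LatticePaths.
Variable d : nat.
Implicit Types (S : {set 'I_d}) (i j s : 'I_d).

Definition height S (m : nat) := #|[set s in S | (val s < m)%N]|.
Definition leS S S' := [forall m : 'I_d, height S m <= height S' m]%N.

Lemma leSP S S' :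
  reflect (forall m, (m < d)%N -> (height S m <= height S' m)%N) (leS S S').
Proof.
apply: (iffP forallP) => h m; last exact: h.
by move=> md; apply: (h (Ordinal md)).
Qed.

Lemma leS_refl : reflexive leS.
Proof. by move=> S; apply/leSP. Qed.

Lemma leS_trans : transitive leS.
Proof.
move=> S2 S1 S3 /leSP h1 /leSP h2; apply/leSP => m md.
exact: leq_trans (h1 m md) (h2 m md).
Qed.

Lemma height0 S : height S 0 = 0%N.
Proof. by apply/eqP; rewrite cards_eq0; apply/eqP/setP=> s; rewrite !inE andbF. Qed.

Lemma heightS S s : height S s.+1 = (height S s + (s \in S))%N.
Proof.
have ltE (x : 'I_d) : (x < s.+1)%N = (x == s :> 'I_d) || (x < s)%N by rewrite ltnS leq_eqVlt.
rewrite /height; case: (boolP (s \in S)) => sS.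
  rewrite (_ : [set x in S | (val x < s.+1)%N] = s |: [set x in S | (val x < s)%N]).
    by rewrite cardsU1 inE ltnn andbF addnC.
  by apply/setP=> x; rewrite !inE ltE; case: eqP => [->|_] //=; rewrite ?sS.
rewrite /= addn0; apply: eq_card => x; rewrite !inE ltE.
by case: eqP => [->|_] //=; rewrite (negPf sS).
Qed.

Lemma height_le S m : (m <= d)%N -> (height S m <= m)%N.
Proof.
elim: m => [|m IH] md; first by rewrite height0.
rewrite (heightS S (Ordinal md)) -addn1 leq_add ?leq_b1 //.
by apply: IH; apply: ltnW.
Qed.

(** The heights below d decide membership of every site but the last, which the parity then
    decides. *)
Lemma height_inj S S' : ~~ odd #|S| -> ~~ odd #|S'| ->
  (forall m, (m < d)%N -> height S m = height S' m) -> S = S'.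
Proof.
move=> oS oS' h.
have memE s : (s.+1 < d)%N -> (s \in S) = (s \in S').
  move=> sd; have := h _ sd; rewrite !heightS h ?(ltnW sd) // => /eqP.
  by rewrite eqn_add2l; do 2 case: (_ \in _).
have oD : ~~ odd #|S :+: S'| by rewrite odd_card_xor (negPf oS) (negPf oS').
suff : S :+: S' = set0.
  by move=> e; rewrite -(xorsetK S' S) e xor0set.
apply/setP=> s; rewrite !inE; apply/negP=> sD.
have sd : (s.+1 >= d)%N.
  by rewrite leqNgt; apply/negP=> /memE e; move: sD; rewrite e addbb.
suff e : S :+: S' = [set s] by move: oD; rewrite e cards1.
apply/setP=> x; rewrite !inE; have [xd|xd] := ltnP x.+1 d.
  rewrite memE // addbb; symmetry; apply/eqP=> e; move: xd; rewrite e; lia.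
have -> : x = s; last by rewrite eqxx.
by apply: val_inj => /=; move: (ltn_ord x) (ltn_ord s); lia.
Qed.

Lemma leS_anti S S' : ~~ odd #|S| -> ~~ odd #|S'| -> leS S S' -> leS S' S -> S = S'.
Proof.
move=> oS oS' /leSP h /leSP h'; apply: height_inj => // m md.
by apply/eqP; rewrite eqn_leq h ?h'.
Qed.

(* In terms of the path, the moves "site j-1 to site j" and "remove the last two
   sites" both lower the height at j by one and leave the other heights below d unchanged. *)
Definition lowerable i j S := (i \in S) && ((j.+1 < d)%N ==> (j \notin S)).

Lemma height_lower i j S m : j = i.+1 :> nat -> lowerable i j S -> (m < d)%N ->
  height S m = (height (S :+: pairset i j) m + (m == j))%N.
Proof.
move=> ji /andP[iS jS]; elim: m => [|m IH] md.
  by rewrite !height0 ji.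
have md' := ltnW md; pose s := Ordinal md'.
rewrite !(heightS _ s) (IH md') !inE -!(inj_eq val_inj) /=.
have [ej|nj] := eqVneq m (j : nat).
  have -> : s = j by apply: val_inj.
  have -> : (m == i) = false by apply/eqP; lia.
  by rewrite (negPf (implyP jS _)) -?ej //=; lia.
have [ei|ni] := eqVneq m (i : nat).
  have -> : s = i by apply: val_inj.
  by rewrite iS ei ji eqxx /=; lia.
have -> : (m.+1 == j) = false by apply/eqP; lia.
by rewrite !addbF /= !addn0.
Qed.

Lemma odd_lower i j S : odd #|S :+: pairset i j| = odd #|S|.
Proof. by rewrite odd_card_xor /pairset odd_card_xor !cards1 addbF. Qed.

(** The upper path has a corner lying strictly above the lower path, and that corner can be cut
    off. *)
Lemma exists_lower S S' : ~~ odd #|S| -> ~~ odd #|S'| -> leS S S' -> S != S' ->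
  exists i j, [/\ j = i.+1 :> nat, lowerable i j S' & leS S (S' :+: pairset i j)].
Proof.
move=> oS oS' leSS' neq; have /leSP h := leSS'.
(* [P m] says that there is a gap at m and that S' has no site m, the last site being exempt. The
   last gap satisfies it, since a site m in S' would carry the gap on to m + 1. *)
pose P m := [&& (m < d)%N, (height S m < height S' m)%N &
  (m.+1 < d)%N ==> [forall s : 'I_d, (val s == m) ==> (s \notin S')]].
have exP : exists m, P m.
  have [m0 m0P] : exists m, (m < d)%N && (height S m < height S' m)%N.
    case: (boolP [exists m : 'I_d, height S m < height S' m]%N) => [/existsP[m hm]|].
      by exists m; rewrite ltn_ord.
    rewrite negb_exists => /forallP h'; case/negP: neq; apply/eqP/leS_anti => //.
    by apply/forallP=> m; rewrite leqNgt h'.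
  have ub m : (m < d)%N && (height S m < height S' m)%N -> (m <= d)%N.
    by case/andP=> /ltnW.
  case: (ex_maxnP (ex_intro _ m0 m0P) ub) => m /andP[md hm] mmax.
  exists m; rewrite /P md hm /=; apply/implyP=> md1; apply/forallP=> s.
  apply/implyP=> /eqP sm; apply/negP=> sS'.
  suff /mmax : (m.+1 < d)%N && (height S m.+1 < height S' m.+1)%N by rewrite ltnn.
  by rewrite md1 -sm !heightS sS' sm; move: hm; case: (_ \in _); lia.
(* At the least such position the preceding site lies in S': otherwise the preceding position would
   satisfy [P] too. *)
case: (ex_minnP exP) => -[|m] /and3P[md hm mP] mmin; first by rewrite !height0 in hm.
have md' := ltnW md; pose i := Ordinal md'; pose j := Ordinal md.
exists i, j; have iS' : i \in S'.
  apply: contraT => iS'; suff /mmin : P m by rewrite ltnn.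
  rewrite /P md' /=; apply/andP; split.
    have := hm; rewrite (heightS S i) (heightS S' i) (negPf iS') /=; lia.
  apply/implyP=> _; apply/forallP=> s; apply/implyP=> /eqP sm.
  by rewrite (_ : s = i) //; apply: val_inj.
have low : lowerable i j S'.
  rewrite /lowerable iS' /=; apply/implyP=> jd.
  by have /forallP/(_ j)/implyP/(_ (eqxx _)) := implyP mP jd.
split=> //; apply/leSP => l ld; have := h l ld.
rewrite (height_lower (erefl : j = i.+1 :> nat) low ld) /=.
by have [->|] := eqVneq l m.+1; have := height_lower (erefl : j = i.+1 :> nat) low md;
  rewrite /= eqxx; lia.
Qed.

(* The cells of the staircase diagram below the path, weighted by powers of b;
   the exponent t encodes row t %/ d, and decreases along each row. *)
Definition cell S (t : nat) := (d.-1 - t %% d < height S (t %/ d))%N.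
Definition weight b S := (\sum_(t < d * d) cell S t * b ^ t)%N.

Lemma cellE S m p : (m < d)%N -> (p < d)%N -> cell S (m * d + (d.-1 - p)) = (p < height S m)%N.
Proof.
move=> md pd; rewrite /cell modnMDl divnMDl ?modn_small ?divn_small ?addn0 //; try lia.
Qed.

Lemma cell_lt m p : (m < d)%N -> (p < d)%N -> (m * d + (d.-1 - p) < d * d)%N.
Proof. by nia. Qed.

(** The move removes exactly the outermost cell of row j, that of column [(height S j).-1]. *)
Lemma weight_lower b i j S : j = i.+1 :> nat -> lowerable i j S ->
  weight b S = (weight b (S :+: pairset i j) + b ^ (j * d + (d - height S j)))%N.
Proof.
move=> ji low; have jd := ltn_ord j.
have hj : (height S j = height (S :+: pairset i j) j + 1)%N.
  by rewrite (height_lower ji low jd) eqxx.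
have hle := height_le S (ltnW jd).
have t0d : (j * d + (d - height S j) < d * d)%N.
  by have := @cell_lt j (height S j).-1 jd; rewrite hj in hle *; nia.
rewrite /weight (bigD1 (Ordinal t0d)) //= [in RHS](bigD1 (Ordinal t0d)) //=.
have cE S1 : cell S1 (j * d + (d - height S j)) = ((height S j).-1 < height S1 j)%N.
  have -> : (d - height S j = d.-1 - (height S j).-1)%N by lia.
  by rewrite cellE //; lia.
rewrite !cE.
rewrite [RHS]addnAC; congr (_ + _)%N; first by rewrite hj addn1 /= ltnn ltnSn /= mul1n mul0n.
apply: eq_bigr => t tt0; congr (_ * _)%N; rewrite /cell.
have td : (t %/ d < d)%N by rewrite ltn_divLR //; lia.
rewrite (height_lower ji low td); have [e|_] := eqVneq; last by rewrite addn0.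
congr nat_of_bool; apply/idP/idP; rewrite e; first last.
  by move=> h; apply: leq_trans h _; lia.
rewrite leq_eqVlt => /orP[/eqP h|]; last by rewrite addn1.
case/negP: tt0; rewrite -(inj_eq val_inj) /= [X in X == _](divn_eq t d) e.
by rewrite eqn_add2l; move: (ltn_pmod t (leq_ltn_trans (leq0n _) jd)); rewrite hj; lia.
Qed.

End LatticePaths.

(** * Pure spinors supported on an interval of paths *)

Section Spinor.
Variables (d : nat) (rho : 'I_d -> nat) (F : fieldType) (b : nat).
Hypotheses (rho_inj : injective rho) (b_gt1 : (1 < b)%N).
Implicit Types S : {set 'I_d}.

(* 1 + x e for a simple root e of type B_(d-1): at the last two sites, e is the sum of
   the two simple root operators of type D_d, whose product vanishes. *)
Definition raise (i j : 'I_d) (x : {poly F}) psi :=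
  if (j.+1 < d)%N then pairop rho i j true false x psi
  else pairop rho i j true true x (pairop rho i j true false x psi).

Lemma raiseE i j x psi S : i != j -> raise i j x psi S =
  psi S + (if lowerable i j S
           then x * (-1) ^+ #|between rho i j S| * psi (S :+: pairset i j) else 0).
Proof.
move=> ij; rewrite /raise /lowerable; case: ifP => jd.
  by rewrite /pairop /= eqb_id eqbF_neg.
have ji : (j == i) = false by rewrite eq_sym (negPf ij).
rewrite /pairop /pairset !inE !eqxx (negPf ij) ji /= !addbT andbT.
by case: (i \in S); case: (j \in S); rewrite /= ?addr0.
Qed.

(** Induction on the weight of [ga]: take a spinor for the interval up to [ga] with one corner cut
    off, and apply [raise] with the power of X that belongs to the removed cell. *)
Lemma exists_spinor (al ga : {set 'I_d}) :
  ~~ odd #|al| -> ~~ odd #|ga| -> leS al ga ->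
  exists psi : {set 'I_d} -> {poly F},
    [/\ pure rho psi,
        forall S, psi S != 0 -> [&& ~~ odd #|S|, leS al S & leS S ga] &
        forall S, ~~ odd #|S| -> leS al S -> leS S ga -> size (psi S) = (weight b S).+1].
Proof.
move=> oal; have [n] := ubnP (weight b ga); elim: n ga => // n IH ga.
rewrite ltnS => wn oga alga.
have [<-|neq] := eqVneq al ga.
  exists (fun S => if S == al then 'X^(weight b al) else 0); split.
  - exact: (pure_vacuum rho al).
  - by move=> S; case: (eqVneq S al) => [-> _|_]; rewrite ?eqxx // oal leS_refl.
  - move=> S oS h1 h2; rewrite (leS_anti oS oal h2 h1) eqxx size_polyXn //.
have [i [j [ji low alga']]] := exists_lower oal oga alga neq.
have jd := ltn_ord j.
set ga' := ga :+: pairset i j in alga'.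
have oga' : ~~ odd #|ga'| by rewrite odd_lower.
have wga : weight b ga = (weight b ga' + b ^ (j * d + (d - height ga j)))%N.
  exact: weight_lower.
have b0 : (0 < b)%N by apply: ltnW.
have wlt : (weight b ga' < n)%N.
  by apply: leq_trans wn; rewrite wga -addn1 leq_add2l expn_gt0 b0.
have [psi [psiP supp sz]] := IH _ wlt oga' alga'.
have ij : i != j by apply/eqP=> e; move: ji; rewrite e; lia.
have ga'ga : leS ga' ga.
  by apply/leSP=> m md; rewrite (height_lower ji low md) leq_addr.
have hga : height ga j = (height ga' j).+1 by rewrite (height_lower ji low jd) eqxx addn1.
pose x : {poly F} := 'X^(b ^ (j * d + (d - height ga j))).
have up S : lowerable i j S -> leS (S :+: pairset i j) ga' -> leS S ga.
  move=> lowS /leSP h; apply/leSP=> m md.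
  by rewrite (height_lower ji lowS md) (height_lower ji low md) leq_add2r; apply: h.
have zero S : ~~ [&& ~~ odd #|S|, leS al S & leS S ga'] -> psi S = 0.
  by move=> h; apply/eqP; apply: contraNT h => /supp.
exists (raise i j x psi); split.
- rewrite /raise; case: ifP => _; first exact: pure_pairop.
  by do 2 apply: pure_pairop => //.
- move=> S; rewrite raiseE //.
  have [psi0|/supp/and3P[-> -> h] _] := eqVneq (psi S) 0; last first.
    by rewrite (leS_trans h ga'ga).
  rewrite psi0 add0r; case: ifP; rewrite ?eqxx // => lowS.
  have [psi'0|/supp/and3P[o h1 h2] _] := eqVneq (psi (S :+: pairset i j)) 0.
    by rewrite psi'0 mulr0 eqxx.
  rewrite odd_lower in o; rewrite o (up _ lowS h2) andbT /=.
  apply: leS_trans h1 _; apply/leSP=> m md.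
  by rewrite [leqRHS](height_lower ji lowS md) leq_addr.
move=> S oS alS Sga; rewrite raiseE //.
have szT : psi (S :+: pairset i j) != 0 ->
    size (x * (-1) ^+ #|between rho i j S| * psi (S :+: pairset i j))
    = (b ^ (j * d + (d - height ga j)) + weight b (S :+: pairset i j)).+1.
  move=> n0; have /and3P[o h1 h2] := supp _ n0.
  rewrite -mulrA size_monicM ?monicXn //; last first.
    by rewrite -size_poly_eq0 size_Msign size_poly_eq0.
  by rewrite size_polyXn size_Msign sz // addnS.
have /leSP hS := Sga.
(* If S was already in the smaller interval, its leading term survives: S would lose a cell of row j
   in an earlier column than the cell of [ga], hence of larger exponent, so the added term has
   smaller degree. *)
have [hj|hj] := leqP (height S j) (height ga' j).
  have Sga' : leS S ga'.
    apply/leSP=> m md; have := hS m md; rewrite (height_lower ji low md).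
    by have [->|_] := eqVneq m j; rewrite ?addn0.
  case: ifP => lowS; last by rewrite addr0 sz.
  have [->|n0] := eqVneq (psi (S :+: pairset i j)) 0; first by rewrite mulr0 addr0 sz.
  rewrite size_polyDl sz // szT // ltnS (weight_lower b ji lowS) addnC ltn_add2l.
  rewrite ltn_exp2l // ltn_add2l ltn_sub2l ?hga ?ltnS //.
  exact: leq_ltn_trans (height_le S (ltnW jd)) jd.
(* Otherwise S touches [ga] at the corner. Then [psi S] vanishes, S can be lowered there, and the
   new coordinate is the added term alone, whose degree is the weight of S. *)
have hSj : height S j = height ga j.
  by apply/eqP; rewrite eqn_leq hS // hga.
have lowS : lowerable i j S.
  have /andP[iga jga] := low; apply/andP; split.
    have := hS i (ltn_ord i); have := hSj; rewrite ji !heightS iga.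
    case: (i \in S) => //= e; rewrite addn0 in e.
    by rewrite e addn1 ltnn.
  apply/implyP=> jd1; have := hS _ jd1; rewrite !heightS hSj.
  by rewrite (negPf (implyP jga jd1)) leq_add2l; case: (j \in S).
rewrite lowS; have [n0|/supp/and3P[_ _ /leSP/(_ j jd)]] := eqVneq (psi S) 0; last first.
  by rewrite leqNgt hj.
rewrite n0 add0r.
have lowle : leS (S :+: pairset i j) ga'.
  apply/leSP=> m md; have := hS m md.
  by rewrite (height_lower ji low md) (height_lower ji lowS md) leq_add2r.
have lowge : leS al (S :+: pairset i j).
  apply/leSP=> m md; have [->|mj] := eqVneq m j.
    have := height_lower ji lowS jd; rewrite eqxx addn1 hSj hga => -[<-].
    by have /leSP/(_ j jd) := alga'.
  by have /leSP/(_ m md) := alS; rewrite (height_lower ji lowS md) (negPf mj) addn0.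
have sz' := sz _ _ lowge lowle; rewrite odd_lower in sz'.
have n1 : psi (S :+: pairset i j) != 0 by rewrite -size_poly_eq0 sz'.
by rewrite szT // (weight_lower b ji lowS) hSj addnC.
Qed.

End Spinor.

(** * Polynomials of distinct degrees, and chains determined by their weight *)

Lemma expansion_inj b n (a a' : nat -> nat) :
  (forall t, a t < b)%N -> (forall t, a' t < b)%N ->
  (\sum_(t < n) a t * b ^ t = \sum_(t < n) a' t * b ^ t)%N ->
  forall t, (t < n)%N -> a t = a' t.
Proof.
elim: n a a' => // n IH a a' ab ab'.
have b0 : (0 < b)%N by apply: leq_ltn_trans (ab 0%N).
have shift (f : nat -> nat) : (\sum_(t < n.+1) f t * b ^ t
    = f 0 + (\sum_(t < n) f t.+1 * b ^ t) * b)%N.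
  rewrite big_ord_recl expn0 muln1 big_distrl; congr (_ + _)%N.
  by apply: eq_bigr => t _; rewrite /= expnSr mulnA.
rewrite !shift => e.
have e0 : a 0%N = a' 0%N.
  by have := congr1 (modn^~ b) e; rewrite ![(_ 0 + _)%N]addnC !modnMDl !modn_small.
move: e; rewrite e0 => /addnI/eqP; rewrite eqn_pmul2r // => /eqP e [|t] // tn.
exact: (IH (fun t => a t.+1) (fun t => a' t.+1) (fun t => ab t.+1) (fun t => ab' t.+1) e).
Qed.

(** Among the terms with nonzero coefficient the one of largest degree is unique, so its leading
    coefficient cannot cancel. *)
Lemma size_lincomb_ge (F : fieldType) (I : finType) (c : I -> F) (q : I -> {poly F}) i :
  (forall i, q i != 0) -> injective (fun i => size (q i)) ->
  c i != 0 -> (size (q i) <= size (\sum_i c i *: q i)%R)%N.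
Proof.
move=> q0 qinj ci; case: (@arg_maxnP _ i (fun i => c i != 0) (fun i => size (q i)) ci).
move=> j cj jmax; apply: leq_trans (jmax i ci) _; rewrite leqNgt; apply/negP => lt.
have szj : (0 < size (q j))%N by rewrite size_poly_gt0.
suff : (\sum_i c i *: q i)`_(size (q j)).-1 != 0.
  by rewrite nth_default ?eqxx // -ltnS prednK.
rewrite coef_sum (bigD1 j) //= big1 ?addr0 => [|l lj].
  by rewrite coefZ mulf_neq0 // -/(lead_coef _) lead_coef_eq0.
rewrite coefZ; have [->|cl] := eqVneq (c l) 0; first by rewrite mul0r.
rewrite (nth_default _ (_ : _ <= _)%N) ?mulr0 //.
have /= := jmax l cl; rewrite leq_eqVlt => /orP[/eqP/qinj e|]; last first.
  by rewrite -(prednK szj) ltnS.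
by rewrite e eqxx in lj.
Qed.

Section Chains.
Variable d : nat.
Implicit Types (S : {set 'I_d}) (L : seq {set 'I_d}).

Definition comparableS S S' := leS S S' || leS S' S.
Definition chain L := {in L &, forall S S', comparableS S S'}.
Definition alleven L := all (fun S => ~~ odd #|S|) L.

Lemma sum_weight b L : (\sum_(S <- L) weight b S
  = \sum_(t < d * d) count (fun S => cell S t) L * b ^ t)%N.
Proof.
rewrite exchange_big /=; apply: eq_bigr => t _; rewrite -big_distrl /=; congr (_ * _)%N.
by rewrite -sum1_count [RHS]big_mkcond; apply: eq_bigr => S _; case: (cell S t).
Qed.

Lemma eq_sorted_count (s s' : seq nat) : size s = size s' ->
  (forall p, count (fun x => p < x)%N s = count (fun x => p < x)%N s') ->
  sorted leq s -> sorted leq s' -> s = s'.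
Proof.
move=> sz h ss ss'; apply: (sorted_eq leq_trans anti_leq) => //.
apply/allP => x _ /=; apply/eqP.
have split r y : (count (fun x => y <= x) r = count_mem y r + count (fun x => y < x) r)%N.
  rewrite -count_predUI [X in (_ + X)%N](_ : _ = 0%N) ?addn0.
    by apply: eq_count => z /=; rewrite leq_eqVlt eq_sym.
  by rewrite (eq_count (a2 := pred0)) ?count_pred0 // => z /=; case: eqP => //= ->; rewrite ltnn.
apply: (@addIn (count (fun y => x < y)%N s')); rewrite -[RHS]split -(h x) -split.
case: x => [|x]; last exact: h.
have z r : count (leq 0) r = size r by rewrite -(count_predT r); apply: eq_count.
by rewrite !z.
Qed.

(** The base exceeds the length, so the digits of the total weight count the members containing each
    cell. They give the multiset of heights at every m, and in a chain sorted by [leS] the heights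
    at all m increase together, which recovers the members. *)
Lemma chain_weight_inj b L L' : alleven L -> alleven L' -> chain L -> chain L' ->
  size L = size L' -> (size L < b)%N ->
  (\sum_(S <- L) weight b S = \sum_(S <- L') weight b S)%N -> perm_eq L L'.
Proof.
move=> eL eL' cL cL' sz szb; rewrite !sum_weight => e.
have cnt t : (t < d * d)%N -> count (fun S => cell S t) L = count (fun S => cell S t) L'.
  move: t; apply: (@expansion_inj b _ (fun t => count (fun S => cell S t) L)
    (fun t => count (fun S => cell S t) L') _ _ e) => t; apply: leq_ltn_trans szb.
    exact: count_size.
  by rewrite sz; exact: count_size.
have sortedL L1 : chain L1 -> sorted (@leS d) (sort (@leS d) L1).
  by move=> c; apply: (sort_sorted_in c); apply/allP=> S.
have mapS L1 m : sorted (@leS d) L1 -> (m < d)%N -> sorted leq (map (fun S => height S m) L1).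
  move=> s md; rewrite sorted_map; apply: sub_sorted s => S S' /leSP; exact.
suff e' : sort (@leS d) L = sort (@leS d) L'.
  by rewrite -(perm_sort (@leS d) L) e' perm_sort.
have hE m : (m < d)%N -> map (fun S => height S m) (sort (@leS d) L)
                       = map (fun S => height S m) (sort (@leS d) L').
  move=> md; apply: eq_sorted_count; rewrite ?mapS ?sortedL //.
    by rewrite !size_map !size_sort.
  move=> p; rewrite !count_map.
  rewrite !(permP (permEl (perm_sort _ _))) /=.
  have [pd|dp] := ltnP p d.
    have := cnt _ (cell_lt md pd).
    by rewrite !(eq_count (fun S => cellE S md pd)).
  have z L1 : count (preim (fun S => height S m) (fun x => p < x)%N) L1 = 0%N.
    rewrite (eq_count (a2 := pred0)) ?count_pred0 // => S /=.
    by apply/negbTE; rewrite -leqNgt (leq_trans (height_le S (ltnW md))) // (leq_trans (ltnW md)).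
  by rewrite !z.
have szs : size (sort (@leS d) L) = size (sort (@leS d) L') by rewrite !size_sort.
apply: (eq_from_nth (x0 := set0) szs) => i il.
have mem L1 : (i < size (sort (@leS d) L1))%N -> alleven L1 ->
    ~~ odd #|nth set0 (sort (@leS d) L1) i|.
  by move=> il1 /allP; apply; rewrite -(mem_sort (@leS d)) mem_nth.
apply: height_inj; rewrite ?mem // -?szs //.
move=> m md; have := congr1 (fun s => nth 0%N s i) (hE m md).
by rewrite /= !(nth_map set0) -?szs.
Qed.

End Chains.

(** * Iterated polynomial rings *)

Section MPolyTheory.

Fact mconst_is_zmod_morphism (k : comNzRingType) n : zmod_morphism (@mconst k n).
Proof. by elim: n => [|n IH] // x y; rewrite /= IH polyCB. Qed.
Fact mconst_is_monoid_morphism (k : comNzRingType) n : monoid_morphism (@mconst k n).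
Proof.
elim: n => [|n [IH1 IHM]] //=; split; first by rewrite IH1 polyC1.
by move=> x y; rewrite IHM polyCM.
Qed.
HB.instance Definition _ (k : comNzRingType) n := GRing.isZmodMorphism.Build
  k (mpoly k n) (@mconst k n) (@mconst_is_zmod_morphism k n).
HB.instance Definition _ (k : comNzRingType) n := GRing.isMonoidMorphism.Build
  k (mpoly k n) (@mconst k n) (@mconst_is_monoid_morphism k n).

Lemma mpoly_eval (R S : comNzRingType) (g : {rmorphism R -> S}) n (v : nat -> S) :
  exists phi : {rmorphism mpoly R n -> S},
    (forall c, phi (mconst n c) = g c) /\
    (forall i, (i < n)%N -> phi (mvar R n i) = v i).
Proof.
elim: n => [|n [phi [phiC phiX]]]; first by exists g.
have comm : commr_rmorph phi (v n) by move=> x; apply: mulrC.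
exists (horner_morph comm : {rmorphism {poly mpoly R n} -> S}); split=> [c|i] /=.
  by rewrite horner_morphC phiC.
rewrite ltnS leq_eqVlt; case: eqP => [-> _|_ /= /phiX <-].
  by rewrite horner_morphX.
by rewrite horner_morphC.
Qed.

Lemma mpoly_ind (k : comNzRingType) n (Q : mpoly k n -> Prop) :
  (forall c, Q (mconst n c)) -> (forall i, (i < n)%N -> Q (mvar k n i)) ->
  (forall x y, Q x -> Q y -> Q (x + y)) -> (forall x y, Q x -> Q y -> Q (x * y)) ->
  forall x, Q x.
Proof.
elim: n Q => [|n IH] Q QC QX QD QM x; first exact: QC.
have QP c : Q (c%:P : {poly mpoly k n}).
  apply: (IH (fun c => Q (c%:P : {poly mpoly k n}))) => [b|i lt|y z Qy Qz|y z Qy Qz].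
  - exact: QC.
  - by have := QX i (ltnW lt); rewrite /= ltn_eqF.
  - by rewrite polyCD; apply: QD.
  - by rewrite polyCM; apply: QM.
have QXn : Q ('X : {poly mpoly k n}) by have := QX n (ltnSn n); rewrite /= eqxx.
elim/poly_ind: (x : {poly mpoly k n}) => [|p c IHp]; first exact: (QP 0).
by apply: QD => //; apply: QM.
Qed.

Lemma mpoly_int_torsion n (h : mpoly int n) m : (0 < m)%N -> h *+ m = 0 -> h = 0.
Proof.
move=> m0; elim: n h => [|n IH] h.
  by move=> /eqP; rewrite Num.Theory.mulrn_eq0 -leqn0 leqNgt m0 => /eqP.
move=> e; apply/(@polyP (mpoly int n)) => i; rewrite coef0; apply: IH.
by have := congr1 (fun p : {poly mpoly int n} => p`_i) e; rewrite /= coefMn coef0.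
Qed.

Lemma MPoly_eval (R S : comNzRingType) (g : {rmorphism R -> S}) (V : finType) (v : V -> S) :
  exists phi : {rmorphism MPoly R V -> S},
    (forall c, phi (MConst V c) = g c) /\ (forall x, phi (MVar R x) = v x).
Proof.
have [phi [phiC phiX]] := mpoly_eval g #|V|
  (fun i => if insub i is Some j then v (enum_val (j : 'I_#|V|)) else 0).
exists phi; split=> [c|x]; first exact: phiC.
by rewrite phiX ?ltn_ord // valK enum_rankK.
Qed.

Lemma MPoly_ind (k : comNzRingType) (V : finType) (Q : MPoly k V -> Prop) :
  (forall c, Q (MConst V c)) -> (forall x, Q (MVar k x)) ->
  (forall x y, Q x -> Q y -> Q (x + y)) -> (forall x y, Q x -> Q y -> Q (x * y)) ->
  forall x, Q x.
Proof.
move=> QC QX; apply: mpoly_ind => [c|i lt]; first exact: QC.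
by have := QX (enum_val (Ordinal lt)); rewrite /MVar enum_valK.
Qed.

End MPolyTheory.

Lemma rmorph_pf_rec (R S : comNzRingType) (phi : {rmorphism R -> S}) (T : Type)
    (a : T -> T -> R) fuel l :
  phi (pf_rec a fuel l) = pf_rec (fun x y => phi (a x y)) fuel l.
Proof.
elim: fuel l => [|fuel IH] [|x l] /=; rewrite ?rmorph1 // rmorph_sum.
by apply: eq_bigr => p _; rewrite !rmorphM rmorph_sign IH.
Qed.

Lemma pf_rec_map (R : comNzRingType) (T U : Type) (f : T -> U) (a : U -> U -> R) fuel l :
  pf_rec a fuel (map f l) = pf_rec (fun x y => a (f x) (f y)) fuel l.
Proof.
elim: fuel l => [|fuel IH] [|x l] //=; rewrite size_map.
apply: eq_bigr => p _; rewrite -map_take -map_drop -map_cat IH.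
by rewrite (nth_map x).
Qed.

Lemma eq_pf_rec (R : comNzRingType) (T : Type) (a b : T -> T -> R) fuel l :
  a =2 b -> pf_rec a fuel l = pf_rec b fuel l.
Proof.
move=> ab; elim: fuel l => [|fuel IH] [|x l] //=.
by apply: eq_bigr => p _; rewrite ab IH.
Qed.

(** * Quadratic straightening *)

Lemma eq_sign (R : pzRingType) m n : odd m = odd n -> (-1) ^+ m = (-1) ^+ n :> R.
Proof. by move=> e; rewrite -signr_odd e signr_odd. Qed.

Section ExchangeModule.
Variables (d : nat) (rho : 'I_d -> nat) (R : comNzRingType).
Variables (f : {set 'I_d} -> R) (S S' : {set 'I_d}).
Implicit Types D x : {set 'I_d}.
Let U := S :+: S'.

(* By the Wick relations the sum of the flips D |-> D :+: [set i], i in U, kills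
   exchange; fourier x is the part of exchange where the flip at i has eigenvalue -1
   if i is in x and 1 otherwise. *)
Definition exchange_sign D : R := \prod_(i in D) (-1) ^+ before rho U i.
Definition exchange D := exchange_sign D * (f (S :+: D) * f (S' :+: D)).
Definition fourier x := \sum_(D : {set 'I_d} | D \subset U) (-1) ^+ #|D :&: x| * exchange D.

Lemma signX D x y : (-1 : R) ^+ #|(D :+: x) :&: y| = (-1) ^+ #|D :&: y| * (-1) ^+ #|x :&: y|.
Proof.
rewrite -exprD; apply: eq_sign; rewrite oddD -odd_card_xor.
by apply: eq_odd_card => i; rewrite !inE; do 3 case: (_ \in _).
Qed.

Lemma xor_subset D i : i \in U -> (D :+: [set i] \subset U) = (D \subset U).
Proof.
have aux D1 : i \in U -> D1 \subset U -> D1 :+: [set i] \subset U.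
  move=> iU /subsetP h; apply/subsetP=> j; rewrite in_xorset in_set1.
  by case: (boolP (j == i)) => [/eqP-> _|_]; rewrite ?addbF //; apply: h.
move=> iU; apply/idP/idP; last exact: aux.
by move/(aux _ iU); rewrite xorsetK.
Qed.

Lemma exchange_signX D i : i \in U ->
  exchange_sign (D :+: [set i]) = exchange_sign D * (-1) ^+ before rho U i.
Proof.
move=> iU; rewrite /exchange_sign; set e := fun i => (-1) ^+ before rho U i : R.
have ee j : e j * e j = 1 by rewrite -expr2 sqrr_sign.
have split D1 : \prod_(j in D1) e j =
    (if i \in D1 then e i else 1) * \prod_(j in D1 | j != i) e j.
  case: ifP => iD; first by rewrite (bigD1 i).
  rewrite mul1r; apply: eq_bigl => j; rewrite andb_idr // => jD.
  by apply/eqP=> e'; rewrite -e' jD in iD.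
rewrite !split !inE eqxx.
rewrite (eq_bigl (fun j => (j \in D) && (j != i))); last first.
  by move=> j; rewrite !inE; case: (j == i); rewrite ?andbF // addbF.
by rewrite -/(e i); case: (i \in D) => /=; [rewrite mulrAC ee | rewrite mul1r mulrC].
Qed.

(** [exchange_sign] absorbs the signs of the Wick quadric at [S :+: D] and [S' :+: D], which thereby
    becomes the plain sum of the flips. *)
Lemma exchange_sum D : pure rho f -> D \subset U -> \sum_(i in U) exchange (D :+: [set i]) = 0.
Proof.
move=> fP DU; have := fP (S :+: D) (S' :+: D); rewrite /wick.
have -> : S :+: D :+: (S' :+: D) = U by rewrite xorsetACA xorsetv xorset0.
move=> e; rewrite -[RHS](mulr0 (exchange_sign D)) -[in RHS]e mulr_sumr; apply: eq_bigr => i iU.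
by rewrite /exchange exchange_signX // !xorsetA !mulrA.
Qed.

(** The sum of the flips acts on [fourier x] by the integer $|U\setminus x|-|x|$, which is nonzero
    here and so can be divided out. *)
Lemma fourier_eq0 x :
  (forall (h : R) m, (0 < m)%N -> h *+ m = 0 -> h = 0) -> pure rho f ->
  x \subset U -> (#|x|.*2 != #|U|)%N -> fourier x = 0.
Proof.
move=> tf fP xU neq.
have e : (\sum_(i in U) (-1) ^+ #|[set i] :&: x|) * fourier x = 0.
  transitivity (\sum_(D : {set 'I_d} | D \subset U)
      (-1) ^+ #|D :&: x| * \sum_(i in U) exchange (D :+: [set i])); last first.
    by apply: big1 => D DU; rewrite exchange_sum ?mulr0.
  under [RHS]eq_bigr do rewrite mulr_sumr.
  rewrite [RHS]exchange_big mulr_suml; apply: eq_bigr => i iU.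
  rewrite [RHS](reindex_inj (can_inj (xorsetK [set i]))) /= mulr_sumr.
  apply: eq_big => [D|D DU]; first by rewrite xor_subset.
  by rewrite xorsetK signX mulrCA mulrA.
have {e} : (#|U :\: x|%:R - #|x|%:R) * fourier x = 0.
  rewrite -[RHS]e; congr (_ * _); rewrite (bigID (mem x)) /= addrC; congr (_ + _).
    rewrite -sumr_const; apply: eq_big => [i|i /setDP[_ ix]]; first by rewrite in_setD andbC.
    rewrite (_ : _ :&: _ = set0) ?cards0 //.
    by apply/setP=> j; rewrite !inE; case: eqP => // ->; rewrite (negPf ix).
  rewrite -sumr_const -sumrN; apply: eq_big => [i|i ix].
    by rewrite andb_idl // => /(subsetP xU).
  rewrite (_ : _ :&: _ = [set i]) ?cards1 //.
  by apply/setP=> j; rewrite !inE andb_idr // => /eqP->.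
have cU : (#|U| = #|x| + #|U :\: x|)%N.
  by rewrite -(cardsID x U) (setIidPr xU).
rewrite cU -addnn eqn_add2l neq_ltn in neq.
case/orP: neq => lt h.
  apply: (tf _ (#|U :\: x| - #|x|)%N); first by rewrite subn_gt0.
  by rewrite -mulr_natl natrB ?(ltnW lt).
apply: (tf _ (#|x| - #|U :\: x|)%N); first by rewrite subn_gt0.
by rewrite -mulr_natl natrB ?(ltnW lt) // -opprB mulNr h oppr0.
Qed.

(** Only even D contribute, and for these the characters of x and of its complement in U agree. *)
Lemma fourierC x : (forall T : {set 'I_d}, odd #|T| -> f T = 0) -> ~~ odd #|S| ->
  x \subset U -> fourier (U :\: x) = fourier x.
Proof.
move=> f0 oS xU; apply: eq_bigr => D DU.
have [oD|eD] := boolP (odd #|D|).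
  by rewrite /exchange f0 ?mul0r ?mulr0 // odd_card_xor (negPf oS) oD.
congr (_ * _); apply: eq_sign.
have := eD; rewrite -(cardsID x D) oddD.
rewrite (_ : D :\: x = D :&: (U :\: x)); first by do 2 case: (odd _).
apply/setP=> i; rewrite !(in_setD, in_setI); have := subsetP DU i.
by case: (i \in D) => [/(_ isT)->|_]; rewrite ?andbT ?andbF.
Qed.

End ExchangeModule.

(** * Fourier inversion over the subsets of U *)

Section FourierInversion.
Variables (d : nat) (rho : 'I_d -> nat) (P : comNzRingType) (k : fieldType).
Variables (iota : {rmorphism k -> P}) (f : {set 'I_d} -> P) (S S' : {set 'I_d}).
Hypotheses (two0 : 2%:R != 0 :> k) (f0 : forall T : {set 'I_d}, odd #|T| -> f T = 0).
Hypotheses (evS : ~~ odd #|S|).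
Implicit Types D x : {set 'I_d}.
Let U := S :+: S'.
Hypothesis vanish : forall x, x \subset U -> (#|x|.*2 != #|U|)%N -> fourier rho f S S' x = 0.

(** Orthogonality of characters: if D contains i, flipping i in x negates the sum, and 2 is
    invertible. *)
Lemma sum_sign D : D \subset U ->
  \sum_(x : {set 'I_d} | x \subset U) (-1) ^+ #|D :&: x| = (if D == set0 then 2 ^+ #|U| else 0) :> k.
Proof.
move=> DU; case: eqP => [->|/eqP/set0Pn[i iD]].
  rewrite (eq_bigr (fun=> 1)) => [|x _]; last by rewrite set0I cards0.
  rewrite sumr_const -natrX; congr _%:R.
  by rewrite -card_powerset; apply: eq_card => x; rewrite powersetE.
have iU := subsetP DU _ iD.
set s := (LHS); suff e : s = - s.
  apply/eqP; have : s *+ 2 == 0 by rewrite mulr2n {1}e addNr.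
  by rewrite -mulr_natl mulf_eq0 (negPf two0).
rewrite {1}/s (reindex_inj (can_inj (xorsetK [set i]))) /= -sumrN.
apply: eq_big => [x|x xU]; first by rewrite xor_subset.
rewrite setIC signX setIC (_ : [set i] :&: D = [set i]) ?cards1 ?expr1 ?mulrN1 //.
by apply/setP=> j; rewrite !inE andb_idr // => /eqP->.
Qed.

Lemma exchange_fourier D : D \subset U -> iota (2 ^+ #|U|) * exchange rho f S S' D =
  \sum_(x : {set 'I_d} | x \subset U) iota ((-1) ^+ #|D :&: x|) * fourier rho f S S' x.
Proof.
move=> DU; under eq_bigr do rewrite mulr_sumr.
rewrite exchange_big (bigD1 D) //= [X in _ + X]big1 ?addr0.
  under eq_bigr do rewrite mulrA -(rmorph_sign iota) -rmorphM /= -expr2 sqrr_sign rmorph1 mul1r.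
  rewrite sumr_const -[RHS]mulr_natl; congr (_ * _); rewrite rmorphXn rmorph_nat -natrX; congr _%:R.
  by rewrite -card_powerset; apply: eq_card => x; rewrite powersetE.
move=> D' /andP[D'U neq].
under eq_bigr do rewrite mulrA -(rmorph_sign iota) -rmorphM /= -signX.
rewrite -mulr_suml -rmorph_sum /= sum_sign.
  case: eqP => [e|_]; last by rewrite rmorph0 mul0r.
  by case/eqP: neq; rewrite -(xorsetK D' D) e xor0set.
apply/subsetP=> i; rewrite !inE => h; move: (subsetP DU i) (subsetP D'U i) h; rewrite /U !inE.
by case: (i \in D) => h1; case: (i \in D') => h2 //= _; rewrite ?h1 ?h2.
Qed.

(** In the inversion formula only the x of size r survive, and those containing [i0] can be traded
    for their complements. This leaves $\binom{2r-1}{r}$ generators. *)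
Lemma exchange_span r i0 D : i0 \in U -> #|U| = r.*2 -> D \subset U ->
  exists c : {set 'I_d} -> k, exchange rho f S S' D =
    \sum_(x in [set x : {set 'I_d} | (x \subset U :\ i0) && (#|x| == r)])
       iota (c x) * fourier rho f S S' x.
Proof.
move=> i0U cU DU; pose s x : k := (-1) ^+ #|D :&: x|.
exists (fun x => (2 ^+ #|U|)^-1 * (s x + s (U :\: x))).
have iota2 : iota ((2 ^+ #|U|)^-1) * iota (2 ^+ #|U|) = 1.
  by rewrite -rmorphM /= mulVf ?rmorph1 // expf_neq0.
rewrite -[LHS]mul1r -iota2 -mulrA exchange_fourier //.
rewrite (bigID (fun x => #|x| == r)) /= [X in _ + X]big1 ?addr0; last first.
  by move=> x /andP[xU xr]; rewrite vanish ?mulr0 // cU (inj_eq double_inj).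
rewrite (bigID (fun x => i0 \notin x)) /=.
have compl x : x \subset U -> U :\: (U :\: x) = x.
  by move=> xU; rewrite setDDr setDv set0U; apply/setIidPr.
have -> : \sum_(x : {set 'I_d} | (x \subset U) && (#|x| == r) && ~~ (i0 \notin x))
      iota (s x) * fourier rho f S S' x =
    \sum_(x : {set 'I_d} | (x \subset U) && (#|x| == r) && (i0 \notin x))
      iota (s (U :\: x)) * fourier rho f S S' x.
  rewrite (reindex_onto (fun x => U :\: x) (fun x => U :\: x)) /=; last first.
    by move=> x /andP[/andP[xU _] _]; apply: compl.
  apply: eq_big => x.
    rewrite subsetDl in_setD i0U andbT negbK /=.
    case: (boolP (x \subset U)) => xU; last first.
      rewrite /= andbC; apply/negbTE/negP => /andP[/eqP e _]; case/negP: xU.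
      by rewrite -e subsetDl.
    rewrite compl // eqxx andbT /=; case: (i0 \in x); rewrite ?andbF ?andbT //.
    have := cardsID x U; rewrite (setIidPr xU) cU -addnn => e.
    by apply/eqP/eqP => h; apply/eqP; move/eqP: e; rewrite h ?eqn_add2r ?eqn_add2l.
  move=> /andP[_ /eqP e]; rewrite -fourierC //; first by rewrite e.
  exact: subsetDl.
rewrite -big_split mulr_sumr; apply: eq_big => x.
  by rewrite inE subsetD1 andbAC.
by move=> _ /=; rewrite rmorphM rmorphD -mulrA mulrDl.
Qed.

End FourierInversion.

(** * Ballot walks and the number of comparable pairs *)

Section Ballots.
Variable d : nat.
Implicit Types (A S U : {set 'I_d}) (us : seq 'I_d).

(* Subsets of us whose elements, read as down steps in an up-down walk that starts
   at height h, never take the walk below 0. *)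
Fixpoint ballots us h : seq {set 'I_d} :=
  if us is u :: us' then
    ballots us' h.+1 ++ (if h is h'.+1 then [seq [set u] :+: A | A <- ballots us' h'] else [::])
  else [:: set0].

(* Reflection principle: walks of n steps from h staying nonnegative are equinumerous
   with the unrestricted walks whose displacement lies in [-h, h+1]. *)
Lemma size_ballots us h N : (size us < N)%N -> size (ballots us h) =
  (\sum_(k < N) ((size us <= k.*2 + h.+1) && (k.*2 <= size us + h)) * 'C(size us, k))%N.
Proof.
elim: us h N => [|u us IH] h [|N] //= lt.
  rewrite big_ord_recl /= big1 => [|k _]; first by rewrite bin0.
  by rewrite bin0n muln0.
rewrite ltnS in lt; set n := size us in IH lt *.
have sz' : size (if h is h'.+1 then [seq [set u] :+: A | A <- ballots us h'] else [::])
   = (\sum_(k < N) ((0 < h) && (n <= k.*2 + h) && (k.*2 + 1 <= n + h)) * 'C(n, k))%N.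
  case: h => [|h] /=; first by rewrite big1.
  rewrite size_map (IH _ N) //; apply: eq_bigr => k _; congr (nat_of_bool _ * _)%N.
  by clear; lia.
rewrite size_cat sz' (IH _ N) // -big_split /=.
have -> : (\sum_(k < N.+1) ((n < k.*2 + h.+1) && (k.*2 <= n.+1 + h)) * 'C(n.+1, k)
  = \sum_(k < N.+1) ((n < k.*2 + h.+1) && (k.*2 <= n.+1 + h)) * 'C(n, k)
   + \sum_(k < N) ((n < k.+1.*2 + h.+1) && (k.+1.*2 <= n.+1 + h)) * 'C(n, k))%N.
  rewrite !big_ord_recl !bin0 /= -addnA; congr (_ + _)%N; rewrite -big_split /=.
  by apply: eq_bigr => k _; rewrite binS mulnDr.
rewrite big_ord_recr /= (bin_small lt) muln0 addn0 -big_split /=.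
apply: eq_bigr => -[k kN] _ /=; rewrite -!mulnDl; congr (_ * _)%N; clear; lia.
Qed.

Lemma ballots_sub us h A : A \in ballots us h -> {subset A <= us}.
Proof.
elim: us h A => [|u us IH] h A /=.
  by rewrite inE => /eqP-> x; rewrite inE.
rewrite mem_cat => /orP[/IH sub x /sub|]; first by rewrite inE orbC => ->.
case: h => // h /mapP[B /IH sub ->] x; rewrite !inE; case: eqP => //= _.
exact: sub.
Qed.

Lemma ballots_uniq us h : uniq us -> uniq (ballots us h).
Proof.
elim: us h => [|u us IH] h //= /andP[uus uus'].
rewrite cat_uniq IH //=; case: h => [|h] //=.
rewrite map_inj_uniq ?IH // ?andbT; last exact: (can_inj (xorsetKl [set u])).
apply/hasPn => _ /mapP[B /ballots_sub subB ->]; apply/negP => /ballots_sub/(_ u).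
rewrite !inE eqxx (negPf uus); case uB: (u \in B); last by move/(_ isT).
by move/subB: uB; rewrite (negPf uus).
Qed.

Lemma height_sum S m : height S m = (\sum_(i : 'I_d | (i < m)%N) (i \in S))%N.
Proof.
rewrite /height -sum1_card big_mkcond [RHS]big_mkcond; apply: eq_bigr => i _.
by rewrite !inE; case: (i \in S); case: ltnP.
Qed.

Lemma height_xor1 S u m : u \notin S -> height ([set u] :+: S) m = ((u < m) + height S m)%N.
Proof.
move=> uS; rewrite !height_sum; case: ltnP => um.
  rewrite (bigD1 u um) [X in (_ + X)%N](bigD1 u um) /= !inE eqxx (negPf uS) /= add0n.
  by congr (_ + _)%N; apply: eq_bigr => i /andP[_ iu]; rewrite !inE (negPf iu).
rewrite add0n; apply: eq_bigr => i im; rewrite !inE; case: eqP => // e.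
by rewrite e ltnNge um in im.
Qed.

(** As [us] increases, its elements below m are the first steps of the walk; the inequality says
    that the walk is not below 0 after them. *)
Lemma ballots_height us h A m : sorted (relpre val ltn) us -> A \in ballots us h ->
  ((height A m).*2 <= h + count (fun u : 'I_d => u < m) us)%N.
Proof.
elim: us h A => [|u us IH] h A.
  by move=> _; rewrite inE => /eqP->; rewrite height_sum big1 // => i _; rewrite inE.
move=> sus; have sus' := path_sorted sus.
have gtu x : x \in us -> (u < x)%N.
  by move=> xus; have /allP/(_ x xus) := order_path_min (leT := relpre val ltn)
    (fun x y z => @ltn_trans _ _ _) sus.
have low (B : {set 'I_d}) : (m <= u)%N -> {subset B <= us} -> height B m = 0%N.
  move=> mu sub; rewrite height_sum big1 // => i im.
  case iB: (i \in B) => //; have := gtu _ (sub _ iB); lia.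
have uus : u \notin us by apply/negP => /gtu; rewrite ltnn.
rewrite /= mem_cat => /orP[AB|].
  have := IH _ _ sus' AB; have := low A; have := ballots_sub AB.
  by case: ltnP => um sub h1 h2; [lia | rewrite h1 //; lia].
case: h => // h /mapP[B BB ->]; have sub := ballots_sub BB.
have uB : u \notin B by apply/negP => /sub; rewrite (negPf uus).
rewrite height_xor1 //; have := IH _ _ sus' BB; have := low B.
by case: ltnP => um h1 h2; [rewrite /=; lia | rewrite h1 //; lia].
Qed.

Lemma sorted_enum_set U : sorted (relpre val ltn) (enum U).
Proof.
rewrite {1}/enum_mem -enumT sorted_filter //; first by move=> x y z; apply: ltn_trans.
by rewrite -sorted_map val_enum_ord iota_ltn_sorted.
Qed.

Lemma exists_standard S S' r : ~~ odd #|S| -> #|S :+: S'| = r.+1.*2 ->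
  exists L : seq {set 'I_d}, [/\ uniq L, size L = 'C(r.*2.+1, r.+1) &
    forall D, D \in L -> [/\ D \subset S :+: S', ~~ odd #|D| & leS (S :+: D) (S' :+: D)]].
Proof.
move=> oS; set U := S :+: S' => cU.
have szU : size (enum U) = r.+1.*2 by rewrite -cardE.
have : uniq (enum U) by exact: enum_uniq.
have : sorted (relpre val ltn) (enum U) by exact: sorted_enum_set.
have memU x : (x \in enum U) = (x \in U) by exact: mem_enum.
case/lastP: (enum U) szU memU => [|us ul] //.
rewrite size_rcons => -[szus] memU sus; rewrite rcons_uniq => /andP[ulus uus].
have sus' : sorted (relpre val ltn) us.
  by apply: (subseq_sorted _ (subseq_rcons us ul) sus) => x y z; apply: ltn_trans.
have usU x : x \in us -> x \in U by rewrite -memU mem_rcons inE orbC => ->.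
have ulU : ul \in U by rewrite -memU mem_rcons mem_head.
have us_lt x : x \in us -> (x < ul)%N.
  move=> xus; have := sus; rewrite sorted_pairwise; last by move=> y z t; apply: ltn_trans.
  by rewrite pairwise_rcons => /andP[/allP/(_ x xus)].
(* The walk is a ballot on all of U but its last element, whose step is fixed by making D even.
   After an odd number of steps the walk is at height at least 1, so either last step is allowed. *)
pose comp A := if odd #|A| == odd #|S :&: U| then A else [set ul] :+: A.
have ulA A : A \in ballots us 0 -> ul \notin A.
  by move/ballots_sub => sub; apply/negP => /sub; rewrite (negPf ulus).
have compU A : A \in ballots us 0 -> comp A \subset U.
  move=> AB; apply/subsetP => x; rewrite /comp; case: ifP => _.
    by move/(ballots_sub AB)/usU.
  rewrite in_xorset in_set1; case: eqP => [-> //|_] /=.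
  by move/(ballots_sub AB)/usU.
exists [seq comp A :+: (S :&: U) | A <- ballots us 0]; split.
- rewrite map_inj_in_uniq ?ballots_uniq // => A B /ulA ulA1 /ulA ulB1.
  move/(can_inj (xorsetK (S :&: U)))/setP => e; apply/setP => x; have := e x.
  rewrite /comp; have [->|xul] := eqVneq x ul; first by rewrite (negPf ulA1) (negPf ulB1).
  by do 2 case: ifP => _; rewrite ?in_xorset ?in_set1 ?(negPf xul).
- rewrite size_map (@size_ballots _ _ r.*2.+2) ?szus //.
  (* From height 0 in [r.*2.+1] steps, only k = r down steps give a displacement in [0, 1]. *)
  rewrite (bigD1 (inord r)) //= big1 ?addn0.
    rewrite inordK; last by lia.
    rewrite (_ : _ && _ = true) ?mul1n; last by lia.
    have e : (r.*2.+1 - r.+1 = r)%N by rewrite subSS -addnn addnK.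
    by rewrite -(@bin_sub _ r.+1) ?e // ltnS -addnn leq_addr.
  move=> [k kr]; rewrite -(inj_eq val_inj) /= inordK; last by lia.
  by move=> kr'; rewrite (_ : _ && _ = false) ?mul0n //; clear -kr kr'; lia.
move=> D /mapP[A AB ->]; have AU := compU A AB.
have evD : ~~ odd #|comp A :+: (S :&: U)|.
  rewrite odd_card_xor /comp; case: eqP => [->|/eqP]; first by rewrite addbb.
  by rewrite odd_card_xor cards1; do 2 case: (odd _).
split=> //.
  apply/subsetP => x; rewrite in_xorset in_setI; have := subsetP AU x.
  by case: (x \in comp A) => [-> //|_] /=; case: (x \in S).
apply/leSP => m md.
(* Inside U the lower set is [comp A] and the upper one its complement; outside U both equal S. So
   domination is the ballot condition on [comp A]. *)
have e : (height (S :+: (comp A :+: (S :&: U))) m + height U m =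
          height (S' :+: (comp A :+: (S :&: U))) m + (height (comp A) m).*2)%N.
  rewrite -addnn !height_sum -!big_split /=; apply: eq_bigr => x _.
  have := subsetP AU x; rewrite /U !inE.
  case: (x \in comp A) => [/(_ isT)|_]; case: (x \in S); case: (x \in S') => //=.
suff h : ((height (comp A) m).*2 <= height U m)%N by clear -h e; lia.
have hU : height U m = (count (fun u : 'I_d => u < m) us + (ul < m))%N.
  transitivity (count (fun u : 'I_d => u < m)%N (rcons us ul)).
    have un : uniq (rcons us ul) by rewrite rcons_uniq ulus.
    rewrite -size_filter -(card_uniqP (filter_uniq _ un)).
    by apply: eq_card => x; rewrite mem_filter memU inE andbC.
  by rewrite -cats1 count_cat /= addn0.
have := ballots_height m sus' AB; rewrite add0n /comp => hA.
case: ifP => _; first by rewrite hU (leq_trans hA) ?leq_addr.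
rewrite height_xor1 ?ulA // hU; case: ltnP => um /=; last by rewrite addn0.
have -> : count (fun u : 'I_d => u < m)%N us = size us.
  apply/eqP; rewrite -all_count; apply/allP => x /us_lt xul; apply: ltn_trans xul um.
(* Twice the height is at most the odd number [r.*2.+1], hence at most [r.*2], which leaves room for
   the last down step. *)
have := leq_trans hA (count_size _ _); rewrite szus => h.
by clear -h; lia.
Qed.
End Ballots.

(** A relation between the rows of M would be one between the v, so M has rank n. With m at most n
    it then has full column rank too, and a left inverse of M expresses the w through the v. *)
Lemma span_of_independent (k : fieldType) (P : comNzRingType) (iota : {rmorphism k -> P})
    n m (v : 'I_n -> P) (w : 'I_m -> P) (M : 'M[k]_(n, m)) :
  (m <= n)%N -> (forall i, v i = \sum_j iota (M i j) * w j) ->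
  (forall c : 'I_n -> k, \sum_i iota (c i) * v i = 0 -> forall i, c i = 0) ->
  forall j, exists c : 'I_n -> k, w j = \sum_i iota (c i) * v i.
Proof.
move=> mn vE indep.
have comb (c : 'rV_n) : \sum_i iota (c 0 i) * v i = \sum_j iota ((c *m M) 0 j) * w j.
  under eq_bigr do rewrite vE mulr_sumr.
  rewrite exchange_big; apply: eq_bigr => j _; rewrite mxE rmorph_sum mulr_suml.
  by apply: eq_bigr => i _; rewrite rmorphM mulrA.
have free : row_free M.
  rewrite -kermx_eq0; apply/rowV0P => c /sub_kermxP cM.
  apply/rowP => i; rewrite [RHS]mxE; apply: (indep (fun i => c 0 i) _ i).
  by rewrite comb cM big1 // => j _; rewrite mxE rmorph0 mul0r.
have full : row_full M.
  by rewrite /row_full eqn_leq rank_leq_col /= (leq_trans mn) //; move/eqP: free => ->.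
have [N NM] := row_fullP full.
move=> j; exists (fun i => N j i).
rewrite -[RHS](eq_bigr _ (fun i _ => congr1 (fun c => iota c * v i) (mxE _ _ _ _ : row j N 0 i = N j i))).
rewrite comb -row_mul NM (bigD1 j) //= big1 ?addr0 => [|l lj].
  by rewrite !mxE eqxx rmorph1 mul1r.
by rewrite !mxE eq_sym (negPf lj) rmorph0 mul0r.
Qed.

(** * Straightening of products into chains *)

Section Straightening.
Variables (d : nat) (rho : 'I_d -> nat) (k : fieldType) (P : comNzRingType).
Variables (iota : {rmorphism k -> P}) (F : {set 'I_d} -> P) (psi : {set 'I_d} -> {poly k}).
Implicit Types S D A : {set 'I_d}.
Hypotheses (two0 : 2%:R != 0 :> k) (F0 : forall S, odd #|S| -> F S = 0).
Hypothesis vanish : forall S S' (x : {set 'I_d}), x \subset S :+: S' -> (#|x|.*2 != #|S :+: S'|)%N ->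
  fourier rho F S S' x = 0.
(* Base 3: the cells of a pair of paths have multiplicity at most 2. *)
Hypothesis size_psi : forall S, ~~ odd #|S| -> size (psi S) = (weight 3 S).+1.
(** Quadratic relations specialize to the spinor [psi], where degrees can be read off. This serves
    twice: for independence and to bound the terms of a straightening relation. *)
Hypothesis transfer : forall (I : finType) (c : I -> k) (A A' : I -> {set 'I_d}),
  \sum_i iota (c i) * (F (A i) * F (A' i)) = 0 ->
  \sum_i c i *: (psi (A i) * psi (A' i)) = 0.

Definition area S := (\sum_(m < d) height S m)%N.

Let w2 S S' := (weight 3 S + weight 3 S')%N.

Lemma size_psi2 S S' : ~~ odd #|S| -> ~~ odd #|S'| ->
  size (psi S * psi S') = (w2 S S').+1.
Proof.
move=> oS oS'; rewrite size_mul -?size_poly_eq0 !size_psi //.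
by rewrite addSn addnS.
Qed.

(** Both pairs are chains of length 2, less than the base 3, so the weight determines them as
    multisets, and the order tells which member is the lower one. *)
Lemma w2_inj S S' A A' : ~~ odd #|S| -> ~~ odd #|S'| -> ~~ odd #|A| -> ~~ odd #|A'| ->
  leS S S' -> leS A A' -> w2 S S' = w2 A A' -> S = A.
Proof.
move=> oS oS' oA oA' le le' e.
have ch T T' : leS T T' -> chain [:: T; T'].
  move=> TT' X Y; rewrite !inE /comparableS => /orP[]/eqP-> /orP[]/eqP->;
  by rewrite ?leS_refl ?TT' ?orbT.
have : perm_eq [:: S; S'] [:: A; A'].
  apply: (@chain_weight_inj _ 3) => //; rewrite /alleven /= ?oS ?oA ?oS' ?oA' //.
  - exact: ch.
  - exact: ch.
  - by rewrite !big_cons !big_nil !addn0.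
move/perm_mem => mem.
have := mem S; rewrite !inE eqxx /= => /esym/orP[/eqP//|/eqP SA'].
have := mem A; rewrite !inE eqxx /= => /orP[/eqP//|/eqP AS'].
by apply: leS_anti => //; [rewrite AS' | rewrite SA'].
Qed.

Lemma height_exchange S S' A A' m : A :+: A' = S :+: S' -> A :&: A' = S :&: S' ->
  (height A m + height A' m = height S m + height S' m)%N.
Proof.
move=> /setP ex /setP ei; rewrite !height_sum -!big_split /=; apply: eq_bigr => i _.
have := ex i; have := ei i; rewrite !inE.
by do 4 case: (_ \in _).
Qed.

(** Equal weights mean equal multisets of cells. A cell of A also lies in A', so it has multiplicity
    two and lies in both S and S'. As these are incomparable, A has smaller area than either; the
    sum of the areas is fixed, so the sum of squares grows. *)
Lemma area_exchange S S' A A' : A :+: A' = S :+: S' -> A :&: A' = S :&: S' ->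
  ~~ comparableS S S' -> leS A A' -> w2 A A' = w2 S S' ->
  (area S ^ 2 + area S' ^ 2 < area A ^ 2 + area A' ^ 2)%N.
Proof.
move=> ex ei ncomp /leSP le e.
have cells m p : (m < d)%N -> (p < d)%N ->
    ((p < height A m) + (p < height A' m) = (p < height S m) + (p < height S' m))%N.
  move=> md pd; have := cell_lt md pd; rewrite -!cellE //; move: (m * d + (d.-1 - p))%N.
  apply: (@expansion_inj 3 _ (fun t => cell A t + cell A' t)%N (fun t => cell S t + cell S' t)%N).
  - by move=> t; do 2 case: (cell _ _).
  - by move=> t; do 2 case: (cell _ _).
  by under eq_bigr do rewrite mulnDl; under [RHS]eq_bigr do rewrite mulnDl; rewrite !big_split.
have leAS m : (m < d)%N -> (height A m <= minn (height S m) (height S' m))%N.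
  move=> md; rewrite leq_min; have hA := height_le A (ltnW md); apply/andP; split.
    rewrite leqNgt; apply/negP => lt; have pd : (height S m < d)%N.
      exact: leq_trans lt (leq_trans hA (ltnW md)).
    have := cells m _ md pd; rewrite lt (leq_trans lt (le m md)) ltnn.
    by case: (_ < _)%N.
  rewrite leqNgt; apply/negP => lt; have pd : (height S' m < d)%N.
    exact: leq_trans lt (leq_trans hA (ltnW md)).
  have := cells m _ md pd; rewrite lt (leq_trans lt (le m md)) ltnn.
  by case: (_ < _)%N.
have area_lt T T' : (forall m, (m < d)%N -> (height A m <= minn (height T m) (height T' m))%N) ->
    ~~ leS T T' -> (area A < area T)%N.
  move=> h; rewrite negb_forall => /existsP[m]; rewrite -ltnNge => lt.
  rewrite /area (bigD1 m) //= [in ltnRHS](bigD1 m) //= -addSn leq_add //.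
    by apply: leq_ltn_trans lt; have := h m (ltn_ord m); rewrite leq_min => /andP[].
  by apply: leq_sum => l _; have := h l (ltn_ord l); rewrite leq_min => /andP[].
move: ncomp; rewrite negb_or => /andP[n1 n2].
have lt1 := area_lt _ _ leAS n1.
have lt2 : (area A < area S')%N.
  by apply: (area_lt _ S) n2 => m md; rewrite minnC; apply: leAS.
have sum : (area A + area A' = area S + area S')%N.
  by rewrite /area -!big_split /=; apply: eq_bigr => m _; apply: height_exchange.
move: lt1 lt2 sum; move: (area A) (area A') (area S) (area S') => a a' s s'; clear; nia.
Qed.

(** The comparable pairs from [exists_standard] give products of distinct degrees in [psi], hence
    independent ones, as many as the generators in [exchange_span]; so they span, and F S F S' is a
    combination of them. *)
Lemma straighten2 S S' : ~~ odd #|S| -> ~~ odd #|S'| -> ~~ comparableS S S' ->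
  exists n (c : 'I_n -> k) (A A' : 'I_n -> {set 'I_d}),
    F S * F S' = \sum_i iota (c i) * (F (A i) * F (A' i)) /\
    forall i, [/\ ~~ odd #|A i| /\ ~~ odd #|A' i|,
      A i :+: A' i = S :+: S', A i :&: A' i = S :&: S' &
      c i != 0 -> (w2 (A i) (A' i) < w2 S S')%N \/
       (w2 (A i) (A' i) = w2 S S' /\
        (area S ^ 2 + area S' ^ 2 < area (A i) ^ 2 + area (A' i) ^ 2)%N)].
Proof.
move=> oS oS' ncomp; pose U := S :+: S'.
have U0 : U != set0.
  apply: contraNneq ncomp => e; rewrite /comparableS -(xorsetK S' S) -/U e xor0set.
  by rewrite leS_refl.
have [i0 i0U] := set0Pn _ U0.
have oU : ~~ odd #|U| by rewrite odd_card_xor (negPf oS) (negPf oS').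
have [r cU] : exists r, #|U| = r.+1.*2.
  exists (#|U|./2).-1; have := odd_double_half #|U|; rewrite (negPf oU) add0n.
  have : (0 < #|U|)%N by rewrite card_gt0.
  by case: (#|U|./2) => [|h] U1 e; rewrite -e in U1 *.
have [L [uL szL LP]] := exists_standard oS cU.
pose D (i : 'I_(size L)) := nth set0 L i.
have DL i : D i \in L by apply: mem_nth.
have Dinj : injective D.
  by move=> i j /eqP; rewrite nth_uniq // => /eqP/val_inj.
have evX (T : {set 'I_d}) i : ~~ odd #|T| -> ~~ odd #|T :+: D i|.
  by move=> oT; have [_ oD _] := LP _ (DL i); rewrite odd_card_xor (negPf oT) (negPf oD).
pose sg (T : {set 'I_d}) : k := exchange_sign rho k S S' T.
have sg0 T : sg T != 0 by apply/prodf_neq0 => i _; rewrite signr_eq0.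
have iota_sg T : iota (sg T) = exchange_sign rho P S S' T.
  by rewrite rmorph_prod; apply: eq_bigr => i _; rewrite rmorph_sign.
have exE T c : iota c * exchange rho F S S' T = iota (c * sg T) * (F (S :+: T) * F (S' :+: T)).
  by rewrite /exchange -iota_sg rmorphM mulrA.
pose q i := psi (S :+: D i) * psi (S' :+: D i).
have szq i : size (q i) = (w2 (S :+: D i) (S' :+: D i)).+1 by rewrite size_psi2 ?evX.
have q0 i : q i != 0 by rewrite -size_poly_eq0 szq.
have qinj : injective (fun i => size (q i)).
  move=> i j; rewrite !szq => -[e]; apply: Dinj; apply: (can_inj (xorsetKl S)).
  have [_ _ li] := LP _ (DL i); have [_ _ lj] := LP _ (DL j).
  by apply: w2_inj e; rewrite ?evX.
have indep (c : 'I_(size L) -> k) :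
    \sum_i iota (c i) * exchange rho F S S' (D i) = 0 -> forall i, c i = 0.
  under eq_bigr do rewrite exE.
  move/transfer => e i; have [//|ci] := eqVneq (c i) 0.
  have := @size_lincomb_ge _ _ (fun i => c i * sg (D i)) q i q0 qinj.
  by rewrite e size_poly0 leqn0 size_poly_eq0 (negPf (q0 i)) mulf_neq0 // => /(_ isT).
pose X := [set x : {set 'I_d} | (x \subset U :\ i0) && (#|x| == r.+1)].
have cX : #|X| = 'C(r.*2.+1, r.+1).
  rewrite cards_draws; congr 'C(_, _); have := cardsD1 i0 U; rewrite i0U cU.
  by rewrite add1n doubleS => -[].
have span (T : {set 'I_d}) : T \subset U -> exists c : 'I_#|X| -> k, exchange rho F S S' T =
    \sum_j iota (c j) * fourier rho F S S' (enum_val j).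
  move=> TU; have [c ->] := exchange_span iota two0 F0 oS (@vanish S S') i0U cU TU.
  by exists (fun j => c (enum_val j)); rewrite big_enum_val.
have [M ME] : exists M : 'M[k]_(size L, #|X|), forall i, exchange rho F S S' (D i) =
    \sum_j iota (M i j) * fourier rho F S S' (enum_val j).
  have /fin_all_exists[c cE] : forall i, exists c : 'I_#|X| -> k,
     exchange rho F S S' (D i) = \sum_j iota (c j) * fourier rho F S S' (enum_val j).
    by move=> i; apply: span; have [] := LP _ (DL i).
  by exists (\matrix_(i, j) c i j) => i; rewrite cE; apply: eq_bigr => j _; rewrite mxE.
(* The two counts agree, so each generator [fourier x] is in turn a combination of the products of
   comparable pairs. *)
have wE := span_of_independent (eq_leq (etrans cX (esym szL))) ME indep.
have [c0 c0E] := span _ (sub0set U).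
have [c cE] : exists c : 'I_(size L) -> k,
    exchange rho F S S' set0 = \sum_i iota (c i) * exchange rho F S S' (D i).
  have /fin_all_exists[N NE] := wE; exists (fun i => \sum_j c0 j * N j i).
  rewrite c0E; under eq_bigr do rewrite NE mulr_sumr.
  rewrite exchange_big; apply: eq_bigr => i _; rewrite rmorph_sum mulr_suml.
  by apply: eq_bigr => j _; rewrite rmorphM mulrA.
exists (size L), (fun i => c i * sg (D i)), (fun i => S :+: D i), (fun i => S' :+: D i).
have FE : F S * F S' = \sum_i iota (c i * sg (D i)) * (F (S :+: D i) * F (S' :+: D i)).
  under eq_bigr do rewrite -exE.
  by rewrite -cE /exchange /exchange_sign big_set0 mul1r !xorset0.
split=> // i; have [DU _ le] := LP _ (DL i).
have eX : S :+: D i :+: (S' :+: D i) = S :+: S' by rewrite xorsetACA xorsetv xorset0.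
have eI : (S :+: D i) :&: (S' :+: D i) = S :&: S'.
  apply/setP => x; have := subsetP DU x; rewrite !inE.
  by case: (x \in D i) => [/(_ isT)|_]; case: (x \in S); case: (x \in S').
split; rewrite ?evX // => ci.
(* The same relation holds for [psi]. Its terms have distinct degrees, so none with nonzero
   coefficient exceeds the degree of the left side. The index [None] stands for the product F S F
   S'. *)
have psiE : psi S * psi S' = \sum_i (c i * sg (D i)) *: q i.
  pose I := option 'I_(size L).
  pose c' (x : I) := if x is Some i then c i * sg (D i) else -1.
  pose A (T : {set 'I_d}) (x : I) := if x is Some i then T :+: D i else T.
  have sumI (V : nmodType) (f : I -> V) : \sum_x f x = f None + \sum_i f (Some i).
    rewrite (bigD1 None) //=; congr (_ + _).
    rewrite (reindex_onto Some (odflt i)) /=; last by case.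
    by apply: eq_bigl => j; rewrite eqxx.
  have := @transfer I c' (A S) (A S').
  rewrite !sumI /= -FE rmorphN1 mulN1r addNr => /(_ erefl)/eqP.
  by rewrite scaleN1r addrC subr_eq0 => /eqP.
have := @size_lincomb_ge _ _ (fun i => c i * sg (D i)) q i q0 qinj ci; rewrite -psiE szq size_psi2 // ltnS.
rewrite leq_eqVlt => /orP[/eqP e|]; last by left.
by right; split=> //; apply: area_exchange.
Qed.

Definition monomial L := \prod_(S <- L) F S.
Definition spanned (Q : seq {set 'I_d} -> Prop) h :=
  exists2 cs : seq (k * seq {set 'I_d}), {in cs, forall cm, Q cm.2} &
    h = \sum_(cm <- cs) iota cm.1 * monomial cm.2.

Lemma spanned_monomial Q L : Q L -> spanned Q (monomial L).
Proof.
move=> QL; exists [:: (1, L)]; first by move=> cm; rewrite inE => /eqP->.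
by rewrite big_seq1 rmorph1 mul1r.
Qed.

Lemma spanned0 Q : spanned Q 0.
Proof. by exists [::]; rewrite ?big_nil. Qed.

Lemma spannedD Q x y : spanned Q x -> spanned Q y -> spanned Q (x + y).
Proof.
move=> [cs Qc ->] [cs' Qc' ->]; exists (cs ++ cs'); last by rewrite big_cat.
by move=> cm; rewrite mem_cat => /orP[/Qc|/Qc'].
Qed.

Lemma spannedZ Q c x : spanned Q x -> spanned Q (iota c * x).
Proof.
move=> [cs Qc ->]; exists [seq (c * cm.1, cm.2) | cm <- cs].
  by move=> _ /mapP[cm /Qc Qcm ->].
by rewrite big_map mulr_sumr; apply: eq_bigr => cm _; rewrite rmorphM mulrA.
Qed.

Lemma spanned_sum Q (T : Type) (s : seq T) (f : T -> P) :
  (forall i, spanned Q (f i)) -> spanned Q (\sum_(i <- s) f i).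
Proof.
move=> h; elim/big_rec: _ => [|i x _]; first exact: spanned0.
exact: spannedD.
Qed.

Lemma spanned_bind Q Q' x : (forall L, Q L -> spanned Q' (monomial L)) ->
  spanned Q x -> spanned Q' x.
Proof.
move=> h [cs Qc ->]; elim: cs Qc => [|cm cs IH] Qc.
  by rewrite big_nil; apply: spanned0.
rewrite big_cons; apply: spannedD.
  by apply/spannedZ/h/Qc; rewrite mem_head.
by apply: IH => cm' cs'; apply: Qc; rewrite inE cs' orbT.
Qed.

Variable be : {set 'I_d}.
(** Twice the degree of the monomial, the degree of one factor being half its number of rows outside
    beta. *)
Definition dist L := (\sum_(S <- L) #|S :+: be|)%N.

Lemma dist_exchange S S' A A' : A :+: A' = S :+: S' -> A :&: A' = S :&: S' ->
  (#|A :+: be| + #|A' :+: be| = #|S :+: be| + #|S' :+: be|)%N.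
Proof.
have cardE (X : {set 'I_d}) : #|X| = (\sum_i (i \in X))%N.
  by rewrite -sum1_card big_mkcond.
move=> /setP ex /setP ei; rewrite !cardE -!big_split /=; apply: eq_bigr => i _.
have := ex i; have := ei i; rewrite !inE.
by do 5 case: (_ \in _).
Qed.

Lemma area_le S : (area S <= d * d)%N.
Proof.
rewrite -[X in (_ <= X * d)%N]card_ord -sum_nat_const; apply: leq_sum => m _.
by apply: leq_trans (height_le S (ltnW (ltn_ord m))) (ltnW (ltn_ord m)).
Qed.

Lemma straighten L : alleven L ->
  spanned (fun L' => [/\ chain L', alleven L', size L' = size L & dist L' = dist L])
    (monomial L).
Proof.
(* Each step lowers the total weight, or keeps it and spreads the areas apart. *)
pose K (L : seq {set 'I_d}) := (size L * (d * d) ^ 2).+1.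
pose w (L : seq {set 'I_d}) := (\sum_(S <- L) weight 3 S)%N.
pose a (L : seq {set 'I_d}) := (\sum_(S <- L) area S ^ 2)%N.
have aK L1 : (a L1 < K L1)%N.
  rewrite ltnS /a -sum1_size big_distrl /=; apply: leq_sum => S _.
  by rewrite mul1n leq_exp2r // area_le.
(* A lexicographic order in one number: since [a L < K L], a drop of [w] by one outweighs any change
   of [K L - a L]. *)
have [n] := ubnP (w L * K L + (K L - a L)); elim: n L => // n IH L.
rewrite ltnS => ltn evL.
have [chL|] := boolP (allrel (@comparableS d) L L).
  by apply: spanned_monomial; split=> // S S' SL S'L; apply: (allrelP chL).
move/allPn => [S SL /allPn[S' S'L ncomp]].
have SS' : S' != S by apply: contraNneq ncomp => ->; rewrite /comparableS leS_refl.
pose L0 := rem S' (rem S L).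
have pL : perm_eq L (S :: S' :: L0).
  apply: (perm_trans (perm_to_rem SL)); rewrite perm_cons; apply: perm_to_rem.
  by have := S'L; rewrite (perm_mem (perm_to_rem SL)) inE (negPf SS').
have bigL (f : {set 'I_d} -> nat) :
    (\sum_(T <- L) f T = f S + (f S' + \sum_(T <- L0) f T))%N.
  by rewrite (perm_big _ pL) !big_cons.
have oS := allP evL _ SL; have oS' := allP evL _ S'L.
have [m [c [A [A' [FE prop]]]]] := straighten2 oS oS' ncomp.
have -> : monomial L = \sum_i iota (c i) * monomial [:: A i, A' i & L0].
  rewrite /monomial (perm_big _ pL) /= !big_cons mulrA FE mulr_suml.
  by apply: eq_bigr => i _; rewrite !big_cons !mulrA.
apply: spanned_sum => i; have [->|ci] := eqVneq (c i) 0.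
  by rewrite rmorph0 mul0r; apply: spanned0.
apply: spannedZ; have [[oA oA'] ex ei /(_ ci) dec] := prop i.
set L' := [:: A i, A' i & L0].
have szL : size L' = size L by rewrite (perm_size pL).
have dL : dist L' = dist L.
  by rewrite /dist bigL !big_cons !addnA (dist_exchange ex ei).
have evL' : alleven L'.
  rewrite /alleven /= oA oA' /=; apply/allP => T TL0; apply: (allP evL).
  by rewrite (perm_mem pL) !inE TL0 !orbT.
rewrite -szL -dL; apply: IH => //; apply: leq_trans ltn.
have KL : K L' = K L by rewrite /K szL.
have := aK L; have := aK L'; rewrite KL.
have -> : w L = (weight 3 S + weight 3 S' + w L0)%N by rewrite /w bigL addnA.
have -> : a L = (area S ^ 2 + area S' ^ 2 + a L0)%N by rewrite /a bigL addnA.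
have -> : w L' = (weight 3 (A i) + weight 3 (A' i) + w L0)%N by rewrite /w !big_cons addnA.
have -> : a L' = (area (A i) ^ 2 + area (A' i) ^ 2 + a L0)%N by rewrite /a !big_cons addnA.
move: dec (K L); rewrite /w2.
move: (weight 3 S + _)%N (weight 3 (A i) + _)%N (w L0) (a L0) => x x' y z.
move: (area S ^ 2 + _)%N (area (A i) ^ 2 + _)%N => u u'; clear.
by case=> [lt|[-> lt]] KK h1 h2; nia.
Qed.

Definition std L := sorted (@leS d) L &&
  all (fun S => [&& ~~ odd #|S|, S != be & comparableS S be]) L.

Lemma span_std L : F be = 1 -> ~~ odd #|be| -> alleven L -> spanned std (monomial L).
Proof.
move=> F1 obe evL; pose L1 := nseq (dist L).+1 be ++ L.
have -> : monomial L = monomial L1.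
  rewrite /L1; elim: (dist L).+1 => //= n ->.
  by rewrite /monomial big_cons F1 mul1r.
have evL1 : alleven L1 by rewrite /alleven all_cat all_nseq /= obe.
have dL1 : dist L1 = dist L.
  rewrite /L1; elim: (dist L).+1 => //= n <-.
  by rewrite /dist big_cons xorsetv cards0.
apply: spanned_bind (straighten evL1) => L2 [ch ev sz dL2].
(* Each member other than be contributes at least 1 to dist, and size L2 > dist L2. *)
have beL2 : be \in L2.
  apply: contraTT isT => nbe.
  have : (size L2 <= dist L2)%N.
    rewrite -sum1_size /dist [leqLHS]big_seq_cond [leqRHS]big_seq_cond.
    apply: leq_sum => S /andP[SL _]; rewrite card_gt0.
    by apply: contraNneq nbe => e; rewrite -(xorset0 be) -e xorsetC xorsetK.
  by rewrite dL2 sz dL1 size_cat size_nseq; rewrite leqNgt ltnS leq_addr.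
have perm : perm_eq (sort (@leS d) [seq S <- L2 | S != be]) [seq S <- L2 | S != be].
  exact: permEl (perm_sort _ _).
have -> : monomial L2 = monomial (sort (@leS d) [seq S <- L2 | S != be]).
  rewrite /monomial (perm_big _ perm) /= big_filter (bigID (fun S => S != be)) /=.
  by rewrite [X in _ * X]big1 ?mulr1 // => S /negPn/eqP->.
apply: spanned_monomial; apply/andP; split.
  apply: (sort_sorted_in (P := fun S => S \in L2)) => //.
    by apply/allP => S; rewrite mem_filter => /andP[].
rewrite (perm_all _ perm); apply/allP => S; rewrite mem_filter => /andP[-> SL2].
by rewrite (allP ev _ SL2) ch.
Qed.

End Straightening.

(** * The index set I(d) and the patch *)

Lemma all2_leq_count (s t : seq nat) : sorted leq s -> sorted leq t -> size s = size t ->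
  reflect (forall m, count (fun x => x < m)%N t <= count (fun x => x < m)%N s)%N (all2 leq s t).
Proof.
move=> ss st sz; apply: (iffP idP).
  move=> h m; elim: s t h {ss st sz} => [|x s IH] [|y t] //= /andP[xy /IH h].
  by rewrite leq_add //; case: (ltnP y m) => // ym; rewrite (leq_ltn_trans xy ym).
elim: s t ss st sz => [|x s IH] [|y t] //= ss st [sz] h.
have lowC z r m : path leq z r -> (m <= z)%N -> count (fun x => x < m)%N r = 0%N.
  move=> /(order_path_min leq_trans)/allP zr mz; apply/eqP; rewrite -leqn0 leqNgt -has_count.
  by apply/hasPn => w /zr zw; rewrite -leqNgt (leq_trans mz).
have xy : (x <= y)%N.
  by rewrite leqNgt; apply/negP => yx; have := h x; rewrite yx ltnn (lowC x s).
rewrite xy; apply: IH => //; rewrite ?(path_sorted ss) ?(path_sorted st) // => m.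
have := h m; have [ym|my] := ltnP y m; first by rewrite (leq_ltn_trans xy ym) leq_add2l.
by rewrite (lowC y t m).
Qed.

Section Encoding.
Variable d : nat.
Implicit Types (S : {set 'I_d}) (th : {set idx d}).

Lemma leq_double : (d <= d.*2)%N. Proof. by rewrite -addnn leq_addr. Qed.
Definition lo (i : 'I_d) : idx d := widen_ord leq_double i.
Definition hi (i : 'I_d) : idx d := star (lo i).

Lemma val_hi i : val (hi i) = (d.*2 - i.+1)%N. Proof. by []. Qed.
Lemma starK : involutive (@star d). Proof. exact: rev_ordK. Qed.
Lemma star_lo i : star (lo i) = hi i. Proof. by []. Qed.
Lemma star_hi i : star (hi i) = lo i. Proof. exact: starK. Qed.
Lemma lo_inj : injective lo. Proof. by move=> i j /(congr1 val) /= /val_inj. Qed.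
Lemma hi_inj : injective hi. Proof. by move=> i j /(can_inj starK)/lo_inj. Qed.
Lemma hi_ge i : (d <= hi i)%N.
Proof. by rewrite val_hi -addnn -addnBA // leq_addr. Qed.
Lemma lo_hi i j : (lo i == hi j) = false.
Proof. by apply/eqP => /(congr1 val) /= e; have := hi_ge j; rewrite val_hi -e leqNgt ltn_ord. Qed.
Lemma hi_lo i j : (hi i == lo j) = false. Proof. by rewrite eq_sym lo_hi. Qed.

Lemma idxP (x : idx d) : exists i, x = lo i \/ x = hi i.
Proof.
case: (ltnP x d) => xd; first by exists (Ordinal xd); left; apply: val_inj.
have xd' : (star x < d)%N.
  by have := ltn_ord x; move: xd; rewrite /=; move: (nat_of_ord x) => y; clear; lia.
by exists (Ordinal xd'); right; rewrite -[LHS]starK; congr star; apply: val_inj.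
Qed.

Definition pick_side S i := if i \in S then hi i else lo i.
Definition unfold_set S : {set idx d} := [set pick_side S i | i : 'I_d].
Definition fold_set th : {set 'I_d} := [set i | hi i \in th].

Lemma pick_side_inj S : injective (pick_side S).
Proof.
move=> i j; rewrite /pick_side; case: ifP => _; case: ifP => _.
- exact: hi_inj.
- by move/eqP; rewrite hi_lo.
- by move/eqP; rewrite lo_hi.
- exact: lo_inj.
Qed.

Lemma hi_unfold S i : (hi i \in unfold_set S) = (i \in S).
Proof.
apply/imsetP/idP => [[j _]|iS]; last by exists i; rewrite // /pick_side iS.
rewrite /pick_side; case: ifP => [jS /hi_inj-> //|_ /eqP]; by rewrite hi_lo.
Qed.

Lemma lo_unfold S i : (lo i \in unfold_set S) = (i \notin S).
Proof.
apply/imsetP/idP => [[j _]|iS]; last by exists i; rewrite // /pick_side (negPf iS).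
rewrite /pick_side; case: ifP => [_ /eqP|/negbT jS /lo_inj-> //]; by rewrite lo_hi.
Qed.

Lemma unfoldK S : fold_set (unfold_set S) = S.
Proof. by apply/setP => i; rewrite inE hi_unfold. Qed.

Lemma foldK th : inI th -> unfold_set (fold_set th) = th.
Proof.
move=> /and3P[_ /forallP h _]; apply/setP => x; case: (idxP x) => i [->|->].
  rewrite lo_unfold inE; have := h (lo i); rewrite star_lo.
  by do 2 case: (_ \in th).
by rewrite hi_unfold inE.
Qed.

Lemma card_unfold_hi S : #|[set m in unfold_set S | (d <= val m)%N]| = #|S|.
Proof.
rewrite -(card_imset _ hi_inj); apply: eq_card => x; rewrite inE.
case: (idxP x) => i [->|->]; last by rewrite hi_unfold hi_ge andbT mem_imset //; apply: hi_inj.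
rewrite /= leqNgt ltn_ord andbF; symmetry; apply/negP => /imsetP[j _ /eqP].
by rewrite lo_hi.
Qed.

Lemma inI_unfold S : inI (unfold_set S) = ~~ odd #|S|.
Proof.
rewrite /inI card_unfold_hi card_imset ?card_ord ?eqxx //=; last exact: pick_side_inj.
rewrite (_ : [forall _, _] = true) //; apply/forallP => m.
case: (idxP m) => i [->|->]; rewrite ?star_lo ?star_hi hi_unfold lo_unfold;
by case: (i \in S).
Qed.

Lemma even_fold th : inI th -> ~~ odd #|fold_set th|.
Proof. by move=> h; rewrite -inI_unfold foldK. Qed.

Lemma size_entries S : size (sorted_entries (unfold_set S)) = d.
Proof.
rewrite size_sort size_map -cardE card_imset ?card_ord //; exact: pick_side_inj.
Qed.

Lemma count_entries S m : count (fun x => x < m)%N (sorted_entries (unfold_set S))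
  = (\sum_(i : 'I_d) (pick_side S i < m))%N.
Proof.
rewrite (permP (permEl (perm_sort _ _))) count_map.
have /permP -> : perm_eq (enum (unfold_set S)) [seq pick_side S i | i <- enum 'I_d].
  apply: uniq_perm; first exact: enum_uniq.
    by rewrite (map_inj_uniq (@pick_side_inj S)) enum_uniq.
  move=> x; rewrite mem_enum; apply/imsetP/mapP => -[i _ ->]; exists i => //.
  by rewrite mem_enum.
rewrite count_map -sum1_count big_mkcond /= big_enum /=.
by apply: eq_bigr => i _ /=; case: (_ < _)%N.
Qed.

Lemma count_entries_lo S m : (m <= d)%N ->
  (count (fun x => x < m)%N (sorted_entries (unfold_set S)) + height S m = m)%N.
Proof.
move=> md; rewrite count_entries height_sum [X in (_ + X)%N]big_mkcond -big_split /=.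
transitivity (\sum_(i < d) (i < m))%N.
  apply: eq_bigr => i _; rewrite /pick_side; case: (i \in S).
    rewrite [X in (X + _)%N](_ : _ = 0%N) ?add0n; first by case: (i < m)%N.
    by rewrite ltnNge (leq_trans md) ?hi_ge.
  by case: (i < m)%N.
rewrite (eq_bigr (fun i : 'I_d => if (i < m)%N then 1 else 0)%N) => [|i _]; last by case: (_ < _)%N.
by rewrite -big_mkcond /= -(big_ord_widen _ (fun=> 1%N) md) sum1_card card_ord.
Qed.

(** An entry in the top m positions is the star of a site of S below m, so the thresholds above d
    repeat the conditions of those below. *)
Lemma count_entries_hi S m : (m <= d)%N ->
  (count (fun x => x < d.*2 - m)%N (sorted_entries (unfold_set S)) + height S m = d)%N.
Proof.
move=> md; rewrite count_entries height_sum [X in (_ + X)%N]big_mkcond -big_split /=.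
rewrite -[RHS]card_ord -sum1_card; apply: eq_bigr => i _.
rewrite /pick_side; have id := ltn_ord i; have dd : d.*2 = (d + d)%N by rewrite addnn.
case: (i \in S).
  by rewrite val_hi; case: (ltnP i m) => im; [have -> : (d.*2 - i.+1 < d.*2 - m)%N = false by lia
    | have -> : (d.*2 - i.+1 < d.*2 - m)%N by lia].
have -> : (lo i < d.*2 - m)%N by rewrite /=; lia.
by case: (i < m)%N.
Qed.

Hypothesis d_gt0 : (0 < d)%N.

(** Sorted entries compare as their counting functions do. Reflection reduces all thresholds to
    those up to d, and the one at d follows from that at d - 1 because both cardinals are even. *)
Lemma leI_unfold S S' : ~~ odd #|S| -> ~~ odd #|S'| ->
  leI (unfold_set S) (unfold_set S') = leS S S'.
Proof.
move=> oS oS'; have sorted_e T : sorted leq (sorted_entries (unfold_set T)).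
  exact: (sort_sorted leq_total).
have := all2_leq_count (sorted_e S) (sorted_e S'); rewrite !size_entries => /(_ erefl) P.
apply/P/leSP => h m.
  move=> md; have := h m; have := count_entries_lo S (ltnW md).
  have := count_entries_lo S' (ltnW md); clear; lia.
have {}h m1 : (m1 <= d)%N -> (height S m1 <= height S' m1)%N.
  rewrite leq_eqVlt => /orP[/eqP->|]; last exact: h.
  have pd : (d.-1 < d)%N by rewrite prednK.
  have cardE (T : {set 'I_d}) : height T d = #|T| by apply: eq_card => x; rewrite inE andb_idr // => _; exact: ltn_ord.
  have heightd (T : {set 'I_d}) : height T d = (height T d.-1 + (Ordinal pd \in T))%N.
    by rewrite -(heightS T (Ordinal pd)) /= prednK.
  have := h _ pd; move: oS oS'; rewrite -!cardE !heightd.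
  by move: (height S _) (height S' _) => u v; do 2 case: (_ \in _); clear; lia.
have [md|dm] := leqP m d.
  by have := h _ md; have := count_entries_lo S md; have := count_entries_lo S' md; clear; lia.
have md : (d.*2 - m <= d)%N by move: dm; clear; lia.
have := h _ md; have := count_entries_hi S md; have := count_entries_hi S' md.
have [m2|m2] := leqP m d.*2; first by rewrite subKn //; clear; lia.
have full (T : {set 'I_d}) : count (fun x => x < m)%N (sorted_entries (unfold_set T)) = d.
  rewrite count_entries -[RHS]card_ord -sum1_card; apply: eq_bigr => i _.
  by rewrite (ltn_trans (ltn_ord _) m2).
by rewrite !full.
Qed.

Lemma leI_fold th th' : inI th -> inI th' -> leI th th' = leS (fold_set th) (fold_set th').
Proof. by move=> h h'; rewrite -leI_unfold ?even_fold // !foldK. Qed.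

Lemma exists_top : exists2 S : {set 'I_d}, ~~ odd #|S| & forall S', leS S' S.
Proof.
have heightT m : (m <= d)%N -> height [set: 'I_d] m = m.
  move=> md; rewrite height_sum (eq_bigr (fun=> 1%N)) => [|i _]; last by rewrite inE.
  by rewrite -(big_ord_widen _ (fun=> 1%N) md) sum1_card card_ord.
have pd : (d.-1 < d)%N by rewrite prednK.
pose S := if odd d then [set: 'I_d] :+: [set Ordinal pd] else [set: 'I_d].
exists S.
  rewrite /S; case: ifP => od; last by rewrite cardsT card_ord od.
  by rewrite odd_card_xor1 cardsT card_ord od.
move=> S'; apply/leSP => m md; apply: leq_trans (height_le S' (ltnW md)) _.
rewrite -[leqLHS](heightT m (ltnW md)) /S; case: ifP => // _.
rewrite !height_sum; apply: leq_sum => i im; rewrite !inE -val_eqE /=.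
by have -> : (i == d.-1 :> nat) = false by move: im md; clear; lia.
Qed.

End Encoding.

Local Notation "x %:F" := (@FracField.tofrac _ x) : ring_scope.

(** * Pfaffian coordinates on the patch *)

Section Patch.
Variables (d : nat) (Sb : {set 'I_d}).
Hypothesis ev_b : ~~ odd #|Sb|.
Implicit Types S : {set 'I_d}.
Let be := unfold_set Sb.

(* The element outside beta of the pair {i, i*}; the Pfaffians order the pairs by it. *)
Definition row_of i : idx d := if i \in Sb then lo i else hi i.
Definition row_pos i : nat := val (row_of i).

Lemma row_inj : injective row_of.
Proof.
move=> i j; rewrite /row_of; case: ifP => _; case: ifP => _.
- exact: lo_inj.
- by move/eqP; rewrite lo_hi.
- by move/eqP; rewrite hi_lo.
- exact: hi_inj.
Qed.

Lemma row_pos_inj : injective row_pos.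
Proof. by move=> i j /val_inj/row_inj. Qed.

Lemma row_out i : row_of i \notin be.
Proof. by rewrite /row_of; case: (boolP (i \in Sb)) => h; rewrite ?lo_unfold ?hi_unfold ?h. Qed.

Lemma star_row i : star (row_of i) \in be.
Proof.
rewrite /row_of; case: (boolP (i \in Sb)) => h.
  by rewrite star_lo hi_unfold.
by rewrite star_hi lo_unfold.
Qed.

Lemma rowP x : x \notin be -> exists i, x = row_of i.
Proof.
case: (idxP x) => i [->|->]; rewrite /be ?lo_unfold ?hi_unfold => h; exists i; rewrite /row_of.
  by rewrite (negPn h).
by rewrite (negPf h).
Qed.

Lemma row_unfold S i : (row_of i \in unfold_set S) = (i \in S :+: Sb).
Proof.
rewrite in_xorset /row_of; case: (boolP (i \in Sb)) => h.
  by rewrite lo_unfold addbT.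
by rewrite hi_unfold addbF.
Qed.

Definition rows S := sort (relpre row_pos leq) (enum (S :+: Sb)).

Lemma rows_sorted S : sorted (relpre row_pos ltn) (rows S).
Proof.
rewrite -sorted_map ltn_sorted_uniq_leq map_inj_uniq; last exact: row_pos_inj.
rewrite sort_uniq enum_uniq sorted_map sort_sorted // => i j; exact: leq_total.
Qed.

Lemma sort_rows S : sort (fun x y : idx d => (val x <= val y)%N) (enum (unfold_set S :\: be))
  = map row_of (rows S).
Proof.
apply: (sorted_eq (leT := fun x y : idx d => (val x <= val y)%N)).
- by move=> x y z; apply: leq_trans.
- by move=> x y /anti_leq/val_inj.
- by apply: sort_sorted => x y; apply: leq_total.
- rewrite sorted_map; apply: sub_sorted (rows_sorted S) => i j; exact: ltnW.
apply: uniq_perm; rewrite ?sort_uniq ?enum_uniq //.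
  by rewrite (map_inj_uniq row_inj) sort_uniq enum_uniq.
move=> x; rewrite mem_sort mem_enum in_setD; apply/andP/mapP.
  move=> [/rowP[i ->]]; rewrite row_unfold => iS; exists i => //.
  by rewrite mem_sort mem_enum.
move=> [i]; rewrite mem_sort mem_enum => iS ->.
by rewrite row_out row_unfold.
Qed.

Definition entry (k : comNzRingType) i j := Xv k be (row_of i, star (row_of j)).

Lemma fplE (k : comNzRingType) S :
  fpl k (unfold_set S) be = pf_rec (entry k) (size (rows S)) (rows S).
Proof. by rewrite /fpl sort_rows /pfaff size_map pf_rec_map. Qed.

Lemma pf_rows (R : comNzRingType) (a : 'I_d -> 'I_d -> R) psi S :
  pure row_pos psi -> psi Sb = 1 ->
  (forall i j, (row_pos i < row_pos j)%N -> a i j = psi (Sb :+: pairset i j)) ->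
  ~~ odd #|S| -> pf_rec a (size (rows S)) (rows S) = psi S.
Proof.
move=> psiP psi1 aE oS; rewrite (pure_pf_rec psiP psi1 aE) ?rows_sorted //; last first.
  by rewrite size_sort -cardE odd_card_xor (negPf oS) (negPf ev_b).
congr psi; apply/setP => i; rewrite in_xorset inE mem_sort mem_enum in_xorset.
by case: (i \in S); case: (i \in Sb).
Qed.

(** Zero on odd sets, so that the Pfaffians become a half-spin vector to which [pure] applies. *)
Definition local_coord (k : comNzRingType) S : Pring k be :=
  if odd #|S| then 0 else fpl k (unfold_set S) be.

Lemma local_coord_even (k : comNzRingType) S :
  ~~ odd #|S| -> local_coord k S = fpl k (unfold_set S) be.
Proof. by rewrite /local_coord => /negPf->. Qed.

Lemma local_coord_odd (k : comNzRingType) S : odd #|S| -> local_coord k S = 0.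
Proof. by rewrite /local_coord => ->. Qed.

(** The generic pure spinor whose coordinates at distance two are the variables has these Pfaffians
    as its coordinates, so they inherit the Wick relations. *)
Lemma local_coord_spinor (k : comNzRingType) :
  [/\ pure row_pos (local_coord k), local_coord k Sb = 1 &
   forall i j, (row_pos i < row_pos j)%N -> local_coord k (Sb :+: pairset i j) = entry k i j].
Proof.
have [psi [psiP psi1 psi0 psiE]] := exists_pure_generic row_pos_inj Sb (entry k).
have E : psi =1 local_coord k.
  move=> S; rewrite /local_coord; case: ifPn => oS.
    by rewrite psi0 // odd_card_xor oS (negPf ev_b).
  by rewrite fplE (pf_rows psiP psi1) // => i j /psiE.
split; last by move=> i j /psiE <-; rewrite E.
  exact: eq_pure psiP.
by rewrite -E.
Qed.

Lemma local_coord_rmorph (R k : comNzRingType) (Phi : {rmorphism Pring R be -> Pring k be}) S :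
  (forall v, Phi (MVar R v) = MVar k v) -> Phi (local_coord R S) = local_coord k S.
Proof.
move=> PhiX; rewrite /local_coord; case: ifP => _; first exact: rmorph0.
rewrite !fplE rmorph_pf_rec; apply: eq_pf_rec => i j.
by rewrite /entry /Xv; case: insub => [v|]; rewrite ?rmorph0 ?PhiX.
Qed.

Lemma fourier_local_coord (k : comNzRingType) S S' (x : {set 'I_d}) :
  x \subset S :+: S' -> (#|x|.*2 != #|S :+: S'|)%N ->
  fourier row_pos (local_coord k) S S' x = 0.
Proof.
(* The eigenvalue |U| - 2|x| of the sum of the flips may vanish in k, not in int. *)
move=> xU neq; have [Phi [_ PhiX]] := @MPoly_eval int (Pring k be) intr (Rvar be) (@MVar k _).
have [zP _ _] := local_coord_spinor int.
have := fourier_eq0 (@mpoly_int_torsion _) zP xU neq.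
move/(congr1 Phi); rewrite rmorph0 => <-.
rewrite /fourier rmorph_sum; apply: eq_bigr => D _.
rewrite rmorphM rmorph_sign /exchange !rmorphM !(local_coord_rmorph _ PhiX).
congr (_ * (_ * _)); rewrite rmorph_prod; apply: eq_bigr => i _.
by rewrite rmorph_sign.
Qed.

(** Divided by its coordinate at beta, a pure spinor is a point of the patch over the fraction
    field. Evaluating the variables at its coordinates at distance two sends every Pfaffian to the
    corresponding coordinate. *)
Lemma frac_eval (k : fieldType) (psi : {set 'I_d} -> {poly k}) :
  pure row_pos psi -> psi Sb != 0 -> (forall S, odd #|S| -> psi S = 0) ->
  exists Phi : {rmorphism Pring k be -> {fraction {poly k}}},
    (forall c, Phi (MConst (Rvar be) c) = (c%:P)%:F) /\
    (forall S, Phi (local_coord k S) = (psi S)%:F / (psi Sb)%:F).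
Proof.
move=> psiP psib psi0; pose chi S := (psi Sb)%:F^-1 * (psi S)%:F.
have b0 : (psi Sb)%:F != 0 by rewrite tofrac_eq0.
have chiP : pure row_pos chi.
  apply: pure_scale => B B'; have := psiP B B' => /(congr1 (@FracField.tofrac _)).
  rewrite rmorph0 => <-; rewrite /wick rmorph_sum; apply: eq_bigr => i _.
  by rewrite !rmorphM rmorph_sign.
have chib : chi Sb = 1 by rewrite /chi mulVf.
pose v (x : Rvar be) := chi (Sb :+: [set i | (row_of i == (val x).1)
                                          || (row_of i == star (val x).2)]).
pose g : {rmorphism k -> {fraction {poly k}}} := (@FracField.tofrac {poly k}) \o polyC.
have [Phi [PhiC PhiX]] := MPoly_eval g v.
exists Phi; split=> [c|S]; first exact: PhiC.
rewrite mulrC -/(chi S) /local_coord; case: ifPn => oS.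
  by rewrite rmorph0 /chi (psi0 S) // tofrac0 mulr0.
rewrite fplE rmorph_pf_rec; apply: pf_rows => // i j ij.
have inR : (row_of i, star (row_of j)) \in Rset be.
  rewrite inE row_out star_row.
  by rewrite -/(row_pos i) (_ : star (_, _).2 = row_of j) // starK.
rewrite /entry /Xv insubT PhiX /v /=; congr (chi (_ :+: _)); apply/setP => l.
rewrite starK !inE !(inj_eq row_inj).
by case: eqP => [->|]; case: eqP => // e; move: ij; rewrite -?e ltnn.
Qed.

End Patch.

(** * Standard monomials and the ideal of the Richardson patch *)

Section StandardMonomials.
Variables (d : nat) (Sa Sb Sg : {set 'I_d}).
Hypotheses (d_gt0 : (0 < d)%N).
Hypotheses (ev_a : ~~ odd #|Sa|) (ev_b : ~~ odd #|Sb|) (ev_g : ~~ odd #|Sg|).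
Hypotheses (le_ab : leS Sa Sb) (le_bg : leS Sb Sg).
Implicit Types (S : {set 'I_d}) (L : seq {set 'I_d}).
Let al := unfold_set Sa.
Let be := unfold_set Sb.
Let ga := unfold_set Sg.

Lemma unfold_inj : injective (@unfold_set d).
Proof. exact: can_inj (@unfoldK d). Qed.

Lemma is_std_on_unfold L : alleven L -> is_std_on al be ga (map (@unfold_set d) L) =
  [&& sorted (@leS d) L, all (fun S => (S != Sb) && comparableS S Sb) L,
      (if L is T :: _ then leS Sa T else true) & leS (last Sg L) Sg].
Proof.
move=> evL; rewrite /is_std_on all_map.
have -> : all (preim (@unfold_set d) (@inI d)) L.
  by apply/allP => S SL /=; rewrite inI_unfold (allP evL).
rewrite sorted_map /=; congr [&& _, _, _ & _].
- apply: (@eq_in_sorted _ (fun S => ~~ odd #|S|)) evL => S S' oS oS' /=.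
  by rewrite leI_unfold.
- rewrite all_map; apply: eq_in_all => S SL /=; have oS := allP evL _ SL.
  rewrite /ltI !leI_unfold // !(inj_eq unfold_inj) eq_sym /comparableS (eq_sym Sb).
  by case: (leS S Sb); case: (leS Sb S); case: (_ == _).
- by case: L evL => [|S L] //= /andP[oS _]; rewrite leI_unfold.
rewrite last_map leI_unfold //; case/lastP: L evL => [|L S] //.
by rewrite last_rcons /alleven all_rcons => /andP[].
Qed.

Lemma sorted_between L S : sorted (@leS d) L -> (if L is T :: _ then leS Sa T else true) ->
  leS (last Sg L) Sg -> S \in L -> leS Sa S && leS S Sg.
Proof.
move=> sL head lastL SL; have := sorted_leq_nth (@leS_trans d) (@leS_refl d) Sg sL.
have iL : (index S L < size L)%N by rewrite index_mem.
move=> mono; apply/andP; split.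
  apply: (@leS_trans _ (nth Sg L 0)).
    by case: (L) SL head.
  have := mono 0%N (index S L); rewrite nth_index // => h; apply: h => //.
  by rewrite inE (leq_ltn_trans _ iL).
apply: leS_trans lastL; rewrite -nth_last.
have := mono (index S L) (size L).-1; rewrite nth_index // => h; apply: h.
- by rewrite inE.
- by rewrite inE prednK // (leq_ltn_trans _ iL).
- by rewrite -ltnS prednK // (leq_ltn_trans _ iL).
Qed.

Lemma sorted_chain L : sorted (@leS d) L -> chain L.
Proof.
move=> sL S S' SL S'L; have := sorted_leq_nth (@leS_trans d) (@leS_refl d) Sg sL.
move=> mono; rewrite -(nth_index Sg SL) -(nth_index Sg S'L) /comparableS.
case/orP: (leq_total (index S L) (index S' L)) => le.
  by rewrite mono ?inE ?index_mem.
by rewrite [X in _ || X]mono ?inE ?index_mem ?orbT.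
Qed.

Section Ideal.
Variable k : comNzRingType.

Lemma inIdeal0 : @inIdeal k d al be ga 0.
Proof. by exists (fun=> 0); rewrite big1 // => ta _; rewrite mul0r. Qed.

Lemma inIdealD h h' : @inIdeal k d al be ga h -> inIdeal al ga h' -> inIdeal al ga (h + h').
Proof.
move=> [g ->] [g' ->]; exists (fun ta => g ta + g' ta).
by rewrite -big_split; apply: eq_bigr => ta _; rewrite mulrDl.
Qed.

Lemma inIdeal_bad (x : Pring k be) ta : bad al ga ta -> inIdeal al ga (x * fpl k ta be).
Proof.
move=> bta; exists (fun ta' => if ta' == ta then x else 0).
rewrite (bigD1 ta) //= eqxx big1 ?addr0 // => ta' /andP[_ /negPf->].
by rewrite mul0r.
Qed.

End Ideal.

(** * Linear independence modulo the ideal *)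

Section Independence.
Variable k : fieldType.

Lemma size_prod_weight (psi : {set 'I_d} -> {poly k}) b L :
  (forall S, S \in L -> size (psi S) = (weight b S).+1) ->
  size (\prod_(S <- L) psi S) = (\sum_(S <- L) weight b S).+1.
Proof.
elim: L => [|S L IH] h; first by rewrite !big_nil size_poly1.
have hS := h S (mem_head _ _).
have {}IH : size (\prod_(S <- L) psi S) = (\sum_(S <- L) weight b S).+1.
  by apply: IH => S' S'L; apply: h; rewrite inE S'L orbT.
by rewrite !big_cons size_mul -?size_poly_eq0 ?hS ?IH // addSn addnS.
Qed.

Lemma independence (cs : seq (k * seq {set idx d})) :
  uniq (map snd cs) -> all (is_std_on al be ga) (map snd cs) ->
  @inIdeal k d al be ga (lincomb be cs) -> all (fun cm => cm.1 == 0) cs.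
Proof.
move=> ucs stdcs [g gE]; pose N := (\max_(cm <- cs) size cm.2)%N.
have leN cm : cm \in cs -> (size cm.2 <= N)%N.
  by move=> cmcs; exact: (leq_bigmax_seq (F := fun cm => size cm.2) cm).
(* The base must exceed 1 and the common length N of the padded chains; [N.+2] does so even when N =
   0. *)
have [psi [psiP supp sz]] := @exists_spinor d (row_pos Sb) k N.+2 (@row_pos_inj d Sb) isT
  Sa Sg ev_a ev_g (leS_trans le_ab le_bg).
have psib : psi Sb != 0 by rewrite -size_poly_eq0 sz.
have psi0 S : odd #|S| -> psi S = 0.
  by move=> oS; apply/eqP; apply: contraTT oS => /supp /and3P[].
have [Phi [PhiC PhiF]] := frac_eval ev_b psiP psib psi0.
have Phif th : inI th -> Phi (fpl k th be) = (psi (fold_set th))%:F / (psi Sb)%:F.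
  by move=> thI; rewrite -PhiF local_coord_even ?even_fold // foldK.
(* The coordinates of [psi] vanish outside the interval, so the evaluation kills every generator of
   the ideal. *)
have Phi0 : Phi (lincomb be cs) = 0.
  rewrite gE rmorph_sum big1 // => ta /andP[taI btA]; rewrite rmorphM Phif //.
  suff -> : psi (fold_set ta) = 0 by rewrite tofrac0 mul0r mulr0.
  apply/eqP; apply: contraTT btA => /supp/and3P[_ h1 h2].
  by rewrite -(foldK taI) !leI_unfold ?even_fold // h1 h2.
pose folds (m : seq {set idx d}) := map (@fold_set d) m.
(* Factors at beta, sent to 1, equalize the lengths of the chains. *)
pose pad m := nseq (N - size m) Sb ++ folds m.
pose q m := \prod_(S <- pad m) psi S.
have stdP cm : cm \in cs -> [/\ map (@unfold_set d) (folds cm.2) = cm.2, alleven (folds cm.2) &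
    is_std_on al be ga (map (@unfold_set d) (folds cm.2))].
  move=> cmcs; have std_m := allP stdcs _ (map_f snd cmcs).
  have /and5P[allI _ _ _ _] := std_m.
  have e : map (@unfold_set d) (folds cm.2) = cm.2.
    rewrite -map_comp -[RHS]map_id; apply/eq_in_map => th /(allP allI); exact: foldK.
  rewrite e; split=> //; rewrite /alleven all_map; apply/allP => th /(allP allI).
  exact: even_fold.
have padP cm : cm \in cs -> [/\ alleven (pad cm.2), chain (pad cm.2), size (pad cm.2) = N &
    forall S, S \in pad cm.2 -> leS Sa S && leS S Sg].
  move=> cmcs; have [e ev] := stdP cm cmcs; rewrite is_std_on_unfold //.
  move=> /and4P[sorted_m comp_m head_m last_m].
  have memP S : S \in pad cm.2 -> S = Sb \/ S \in folds cm.2.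
    by rewrite mem_cat mem_nseq => /orP[/andP[_ /eqP]|]; [left | right].
  split.
  - by rewrite /alleven all_cat all_nseq ev_b orbT.
  - move=> S S' /memP[->|SL] /memP[->|S'L]; first by rewrite /comparableS leS_refl.
    + by have /andP[_] := allP comp_m _ S'L; rewrite /comparableS orbC.
    + by have /andP[_] := allP comp_m _ SL.
    + exact: (sorted_chain sorted_m SL S'L).
  - by rewrite size_cat size_nseq size_map subnK // leN.
  - move=> S /memP[->|SL]; first by rewrite le_ab.
    exact: (sorted_between sorted_m head_m last_m SL).
have szq cm : cm \in cs -> size (q cm.2) = (\sum_(S <- pad cm.2) weight N.+2 S).+1.
  move=> cmcs; have [ev _ _ betw] := padP cm cmcs; apply: size_prod_weight => S SL.
  by have /andP[h1 h2] := betw S SL; rewrite sz // (allP ev).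
pose c (i : 'I_(size cs)) := (nth (0, [::]) cs i).1.
pose m (i : 'I_(size cs)) := (nth (0, [::]) cs i).2.
have mem_i (i : 'I_(size cs)) : nth (0, [::]) cs i \in cs by apply: mem_nth.
have q0 i : q (m i) != 0 by rewrite -size_poly_eq0 szq.
have qinj : injective (fun i => size (q (m i))).
  move=> i j; rewrite !szq // => -[e].
  have [ev_i ch_i sz_i _] := padP _ (mem_i i); have [ev_j ch_j sz_j _] := padP _ (mem_i j).
  have perm : perm_eq (pad (m i)) (pad (m j)).
    by apply: (chain_weight_inj ev_i ev_j ch_i ch_j _ _ e); rewrite sz_i ?sz_j.
  (* No factor of a standard monomial sits at beta, so the padding can be removed again. *)
  have unpad i1 : [seq S <- pad (m i1) | S != Sb] = folds (m i1).
    have [_ ev] := stdP _ (mem_i i1); rewrite is_std_on_unfold // => /and4P[_ comp_m _ _].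
    rewrite filter_cat (eq_in_filter (a2 := pred0)) ?filter_pred0 /=; last first.
      by move=> S; rewrite mem_nseq => /andP[_ /eqP->]; rewrite eqxx.
    by apply/all_filterP/allP => S /(allP comp_m)/andP[].
  have permf : perm_eq (folds (m i)) (folds (m j)).
    by rewrite -!unpad; apply: perm_filter.
  have sorted_f i1 : sorted (@leS d) (folds (m i1)).
    by have [_ ev] := stdP _ (mem_i i1); rewrite is_std_on_unfold // => /and4P[].
  have [ei evi _] := stdP _ (mem_i i); have [ej evj _] := stdP _ (mem_i j).
  have ef : folds (m i) = folds (m j).
    apply: (sorted_eq_in _ _ (sorted_f i) (sorted_f j) permf).
      by move=> S2 S1 S3 _ _ _; apply: leS_trans.
    move=> S S' /(allP evi) oS /(allP evi) oS' /andP[]; exact: leS_anti.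
  have em : m i = m j by rewrite /m -ei -ej -/(m i) -/(m j) ef.
  apply: ord_inj; apply/eqP; rewrite -(nth_uniq [::] _ _ ucs) ?size_map //.
  by rewrite !(nth_map (0, [::])) //; apply/eqP; exact: em.
have nseqE n : \prod_(S <- nseq n Sb) psi S = psi Sb ^+ n.
  by elim: n => [|n IH] /=; rewrite ?big_nil // big_cons IH exprS.
have prodE ths : all (@inI d) ths ->
    Phi (std_mono k be ths) = (\prod_(S <- folds ths) psi S)%:F / (psi Sb)%:F ^+ size ths.
  elim: ths => [|th ths IH] /=; rewrite /std_mono ?big_nil ?rmorph1 ?tofrac1 ?divr1 //.
  move=> /andP[thI /IH {}IH]; rewrite !big_cons rmorphM IH Phif // tofracM exprS invfM.
  by rewrite mulrACA.
(* Multiplying by the N-th power of the coordinate at beta clears all denominators; what remains of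
   it in each term is the padding. *)
have sum0 : \sum_i c i *: q (m i) = 0.
  apply/eqP; rewrite -tofrac_eq0; apply/eqP; rewrite -(mulr0 ((psi Sb)%:F ^+ N)) -Phi0.
  rewrite /lincomb (big_nth (0, [::])) big_mkord !rmorph_sum mulr_sumr; apply: eq_bigr => i _.
  rewrite rmorphM PhiC -mul_polyC [LHS]rmorphM mulrCA; congr (_ * _).
  have b0 : (psi Sb)%:F != 0 by rewrite tofrac_eq0.
  have [e _ _] := stdP _ (mem_i i); rewrite -/(m i) in e *.
  have /and5P[allI _ _ _ _] := allP stdcs _ (map_f snd (mem_i i)).
  rewrite -/(m i) in allI.
  rewrite prodE // /q /pad big_cat /= nseqE tofracM tofracXn mulrCA mulrC; congr (_ * _).
  by rewrite -exprB ?leN ?unitfE.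
apply/(all_nthP (0, [::])) => i ics; apply: contraT => ci.
have := @size_lincomb_ge _ _ c (fun i => q (m i)) (Ordinal ics) q0 qinj ci.
by rewrite sum0 size_poly0 leqn0 size_poly_eq0 (negPf (q0 _)).
Qed.

End Independence.

(** * Spanning modulo the ideal *)

Section Spanning.
Variable k : fieldType.
Hypothesis two0 : 2%:R != 0 :> k.
Let iota : {rmorphism k -> Pring k be} := (@mconst k #|Rvar be|).

(** Each variable is the Pfaffian coordinate of a single pair, so every polynomial is a combination
    of monomials in the coordinates. These are straightened with the help of the spinor of the whole
    interval from the empty set to the top. *)
Lemma spanned_local_coord (h : Pring k be) :
  spanned iota (local_coord Sb k) (std Sb) h.
Proof.
have [St ev_t top] := exists_top d_gt0.
have bot S : leS set0 S.
  by apply/leSP => m _; rewrite height_sum big1 // => i _; rewrite inE.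
have ev0 : ~~ odd #|(set0 : {set 'I_d})| by rewrite cards0.
have [psi [psiP supp sz]] := @exists_spinor d (row_pos Sb) k 3 (@row_pos_inj d Sb) isT
  set0 St ev0 ev_t (bot St).
have psib : psi Sb != 0 by rewrite -size_poly_eq0 sz.
have psi0 S : odd #|S| -> psi S = 0.
  by move=> oS; apply/eqP; apply: contraTT oS => /supp /and3P[].
have [Phi [PhiC PhiF]] := frac_eval ev_b psiP psib psi0.
(* All terms are products of two coordinates, so the square of the coordinate at beta clears the
   denominators. *)
have transfer (I : finType) (c : I -> k) (A A' : I -> {set 'I_d}) :
    \sum_i iota (c i) * (local_coord Sb k (A i) * local_coord Sb k (A' i)) = 0 ->
    \sum_i c i *: (psi (A i) * psi (A' i)) = 0.
  move/(congr1 Phi); rewrite rmorph0 rmorph_sum => e.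
  apply/eqP; rewrite -tofrac_eq0; apply/eqP; rewrite -(mulr0 ((psi Sb)%:F ^+ 2)) -[in RHS]e.
  rewrite rmorph_sum mulr_sumr; apply: eq_bigr => i _.
  have b0 : (psi Sb)%:F != 0 by rewrite tofrac_eq0.
  rewrite rmorphM (PhiC (c i)) rmorphM !PhiF -mul_polyC rmorphM [X in _ * X]rmorphM /=.
  rewrite [RHS]mulrCA; congr (_ * _); rewrite mulf_div -expr2 [RHS]mulrC divfK ?expf_neq0 //.
have [_ F1 FX] := local_coord_spinor ev_b k.
have sp L : alleven L -> spanned iota (local_coord Sb k) (std Sb) (monomial (local_coord Sb k) L).
  apply: (@span_std d (row_pos Sb) k _ iota (local_coord Sb k) psi) => //.
  - exact: local_coord_odd.
  - exact: fourier_local_coord.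
  - by move=> S oS; apply: sz.
suff : spanned iota (local_coord Sb k) (@alleven d) h by apply: spanned_bind.
move: h; apply: MPoly_ind => [c|[[r s] rsR]|x y|x y].
- exists [:: (c, [::])]; first by move=> cm; rewrite inE => /eqP->.
  by rewrite big_seq1 /monomial big_nil mulr1.
- have := rsR; rewrite inE => /and3P[/= rb sb rs].
  have [i ri] := rowP rb.
  have [j sj] : exists j, star s = row_of Sb j.
    apply: rowP; have /and3P[_ /forallP/(_ s) + _] : inI be by rewrite inI_unfold.
    by rewrite sb; case: (_ \in _).
  have ij : (row_pos Sb i < row_pos Sb j)%N by rewrite /row_pos -ri -sj.
  have -> : MVar k (exist _ (r, s) rsR : Rvar be) = monomial (local_coord Sb k) [:: Sb :+: pairset i j].
    rewrite /monomial big_seq1 FX // /entry -ri -sj starK /Xv insubT.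
    by congr MVar; apply: val_inj.
  apply: spanned_monomial; rewrite /alleven /= andbT odd_card_xor (negPf ev_b).
  by rewrite /pairset odd_card_xor !cards1.
- exact: spannedD.
move=> [cs ev ->] [cs' ev' ->].
rewrite mulr_suml big_seq; elim/big_rec: _ => [|cm z cmcs IH]; first exact: spanned0.
apply: spannedD IH; rewrite mulr_sumr big_seq.
elim/big_rec: _ => [|cm' z' cmcs' IH]; first exact: spanned0.
apply: spannedD IH; rewrite mulrACA -rmorphM; apply: spannedZ.
rewrite -[X in spanned _ _ _ X](_ : monomial (local_coord Sb k) (cm.2 ++ cm'.2) = _).
  apply: spanned_monomial; rewrite /alleven all_cat.
  by apply/andP; split; [exact: ev | exact: ev'].
by rewrite /monomial big_cat.
Qed.

Lemma spanning (h : Pring k be) : exists cs : seq (k * seq {set idx d}),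
  all (is_std_on al be ga) (map snd cs) /\ inIdeal al ga (h - lincomb be cs).
Proof.
have [cs std_cs ->] := spanned_local_coord h.
elim: cs std_cs => [|[c L] cs IH] std_cs.
  by exists [::]; split=> //; rewrite /lincomb !big_nil subr0; apply: inIdeal0.
have [cs' [std' I']] := IH (fun cm h => std_cs cm (mem_behead (s := (c, L) :: cs) h)).
have /andP[sL /allP LP] := std_cs (c, L) (mem_head _ _).
have evL : alleven L by apply/allP => S /LP/andP[].
have monE : monomial (local_coord Sb k) L = std_mono k be (map (@unfold_set d) L).
  rewrite /monomial /std_mono big_map big_seq [RHS]big_seq; apply: eq_bigr => S SL.
  by rewrite local_coord_even // (allP evL).
rewrite big_cons; have [stdL|nstdL] := boolP (is_std_on al be ga (map (@unfold_set d) L)).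
  exists ((c, map (@unfold_set d) L) :: cs'); split; first by rewrite /= stdL.
  by rewrite /lincomb big_cons /= monE opprD addrACA subrr add0r.
exists cs'; split=> //; rewrite -addrA; apply: inIdealD I' => /=.
(* If all members lay between alpha and gamma, the first and the last would, and L would be standard
   on Y. *)
have [S SL bS] : exists2 S, S \in L & bad al ga (unfold_set S).
  apply/hasP; apply: contraNT nstdL => /hasPn nb; rewrite is_std_on_unfold // sL /=.
  have good S : S \in L -> leS Sa S && leS S Sg.
    move=> SL; have := nb S SL; have oS := allP evL _ SL.
    by rewrite /bad inI_unfold oS !leI_unfold // -negb_and negbK.
  apply/and3P; split; first by apply/allP => S /LP/and3P[_ -> ->].
    by case: (L) good => // S L' good; have /andP[] := good S (mem_head _ _).
  case/lastP: (L) good => [|L' S] good; first exact: leS_refl.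
  have SL : S \in rcons L' S by rewrite mem_rcons mem_head.
  by rewrite last_rcons; have /andP[] := good S SL.
rewrite monE /std_mono big_map (big_rem S) //= mulrCA mulrC.
exact: inIdeal_bad.
Qed.

End Spanning.
End StandardMonomials.

Theorem theorem8p1 (k : closedFieldType) (d : nat) (al be ga : {set idx d}) :
  (2%:R : k) != 0 -> (0 < d)%N ->
  inI al -> inI be -> inI ga -> leI al be -> leI be ga ->
  (* spanning: every element of P is, modulo I, a k-combination of
     standard monomials on Y^gamma_{alpha,beta} *)
  (forall h : Pring k be,
     exists cs : seq (k * seq {set idx d}),
       all (is_std_on al be ga) (map snd cs) /\
       inIdeal al ga (h - lincomb be cs))
  /\
  (* linear independence modulo I of distinct standard monomials *)
  (forall cs : seq (k * seq {set idx d}),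
     uniq (map snd cs) -> all (is_std_on al be ga) (map snd cs) ->
     inIdeal al ga (lincomb be cs) ->
     all (fun cm => cm.1 == 0) cs).
Proof.
move=> two0 d_gt0 alI beI gaI leab lebg.
move: (even_fold alI) (even_fold beI) (even_fold gaI) leab lebg; rewrite !leI_fold //.
move: (foldK alI) (foldK beI) (foldK gaI).
move: (fold_set al) (fold_set be) (fold_set ga) => Sa Sb Sg ea eb eg; subst.
move=> ev_a ev_b ev_g leab lebg; split; first exact: spanning.
exact: independence.
Qed.
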